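(* Let $\mathcal{G}=(\mathcal{V},\mathcal{E})$ be a connected compact metric graph and $\mathcal{V}_R\subset\mathcal{V}$ a set of $k=|\mathcal{V}_R|\geq 1$ Robin vertices, all equipped with the same real Robin parameter $\alpha<0$. Let $\mathfrak{D}:=\min_{v\in\mathcal{V}_R}\deg v$, let $\ell_{\mathcal{G}}$ be the length of the shortest edge of $\mathcal{G}$, and let $|\mathcal{G}|$ be the total length of $\mathcal{G}$ (the sum of all edge lengths). Then the smallest eigenvalue $\lambda_1(\alpha):=\min\sigma(-\Delta_{\mathcal{V}_R}^\alpha)$ satisfies $$\lambda_1(\alpha)\leq-\frac{\alpha^2}{\mathfrak{D}^2}-\frac{2\alpha}{\mathfrak{D}\ell_{\mathcal{G}}}-\frac{1}{\ell_{\mathcal{G}}^2}=-\left[\frac{\alpha}{\mathfrak{D}}+\frac{1}{\ell_{\mathcal{G}}}\right]^2\qquad\text{if }\alpha<-\frac{\mathfrak{D}}{\ell_{\mathcal{G}}}<0,$$ and $$\lambda_1(\alpha)\leq\frac{k\alpha}{|\mathcal{G}|}\qquad\text{for all }\alpha<0.$$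
   Context: A compact metric graph $\mathcal{G}=(\mathcal{V},\mathcal{E})$ has a finite vertex set $\mathcal{V}$ and a finite edge set $\mathcal{E}$; each edge $e$ is identified with a compact interval $[0,\ell_e]$, $\ell_e>0$, whose endpoints correspond to the vertices incident with $e$. Loops and multiple edges are allowed. $\deg v$ is the number of edges incident with $v$ (loops counted twice). $H^1(\mathcal{G})$ is the set of functions continuous on $\mathcal{G}$ (in particular at all vertices) with $f|_e\in H^1(e)$ for all $e$. The Robin Laplacian $-\Delta_{\mathcal{V}_R}^\alpha$ is the operator on $L^2(\mathcal{G})$ (self-adjoint for real $\alpha$) associated with the form $a_\alpha[f,g]=\int_{\mathcal{G}}f'\overline{g'}\,dx+\alpha\sum_{v\in\mathcal{V}_R}f(v)\overline{g(v)}$, $f,g\in H^1(\mathcal{G})$. *)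

(* Defs.v *)
From HB Require Import structures.
From mathcomp Require Import all_boot all_order all_algebra.
From mathcomp Require Import complex.
From mathcomp Require Import all_classical all_reals all_analysis.
Set Implicit Arguments.
Unset Strict Implicit.
Unset Printing Implicit Defensive.
Import Order.TTheory GRing.Theory Num.Theory.
Import numFieldNormedType.Exports.
Local Open Scope classical_set_scope.
Local Open Scope ring_scope.

Definition is_minimum {d : Order.disp_t} {T : porderType d}
  (A : set T) (x : T) : Prop := A x /\ lbound A x.

(* Edge e is the interval [0, len e]; its endpoint 0 is glued to the vertex
   src e and its endpoint len e to tgt e.  The orientation src -> tgt only
   serves to fix a coordinate.  Loops and multiple edges are allowed. *)
Record metric_graph (R : realType) := MetricGraph {
  vertex : finType;
  edge : finType;
  src : edge -> vertex;
  tgt : edge -> vertex;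
  len : edge -> R;
  len_gt0 : forall e, 0 < len e }.

Section MetricGraph.
Context {R : realType} (G : metric_graph R).

Definition adjacent : rel (vertex G) := fun v w =>
  [exists e : edge G, ((src e == v) && (tgt e == w))
                   || ((src e == w) && (tgt e == v))].

Definition graph_connected : Prop := forall v w, connect adjacent v w.

(* A loop at v contributes to both summands. *)
Definition deg (v : vertex G) : nat :=
  (#|[set e : edge G | src e == v]| + #|[set e : edge G | tgt e == v]|)%N.

Definition edge_lengths : set R := range (@len R G).

Definition total_length : R := \sum_(e : edge G) len e.

(* A complex function f on the graph is given by its values f (inl v) at the
   vertices and f (inr (e, x)) at coordinate x of edge e.  Only coordinates
   x in [0, len e] are ever used.  Membership in H1 imposes the compatibility
   of the two at the endpoints of the edges; for L2, which only sees the edges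
   up to null sets, the vertex values are irrelevant. *)
Definition graph_fun : Type := (vertex G + edge G * R)%type -> R[i].

Definition on_edge (f : graph_fun) (e : edge G) : R -> R[i] :=
  fun x => f (inr (e, x)).

End MetricGraph.

Section Interval.
Context {R : realType}.
Implicit Types (l : R) (h g : R -> R[i]) (phi : R -> R).
Local Notation mu := (@lebesgue_measure R).

Definition cintegral l h : R[i] :=
  Complex (\int[mu]_(x in `[0, l]) complex.Re (h x))
          (\int[mu]_(x in `[0, l]) complex.Im (h x)).

Definition L2_interval l h : Prop :=
  [/\ measurable_fun `[0, l] (fun x => complex.Re (h x)),
      measurable_fun `[0, l] (fun x => complex.Im (h x)) &
      mu.-integrable `[0, l]
        (fun x => (complex.Re (h x) ^+ 2 + complex.Im (h x) ^+ 2)%:E)].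

Definition continuous_interval l h : Prop :=
  {within `[0, l], continuous (fun x => complex.Re (h x))} /\
  {within `[0, l], continuous (fun x => complex.Im (h x))}.

(* Continuously differentiable functions with compact support in ]0, l[. *)
Definition test_function l phi : Prop :=
  [/\ forall x, derivable phi x 1,
      continuous (derive1 phi) &
      exists a b, [/\ 0 < a, b < l & forall x, phi x != 0 -> a <= x <= b]].

Definition weak_derivative l h g : Prop :=
  forall phi, test_function l phi ->
    cintegral l (fun x => h x * (derive1 phi x)%:C%C) =
    - cintegral l (fun x => g x * (phi x)%:C%C).

Definition H1_interval l h : Prop :=
  L2_interval l h /\ exists g, L2_interval l g /\ weak_derivative l h g.

(* The weak derivative, unique up to null sets; 0 if h is not in H1(0, l). *)
Definition wderiv l h : R -> R[i] :=
  xget (fun=> 0) [set g | L2_interval l g /\ weak_derivative l h g].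

End Interval.

Section RobinLaplacian.
Context {R : realType} (G : metric_graph R).
Implicit Types f g h u w : graph_fun G.
Local Notation mu := (@lebesgue_measure R).

Definition L2 f : Prop := forall e, L2_interval (len e) (on_edge f e).

Definition inner f g : R[i] :=
  \sum_(e : edge G)
    cintegral (len e) (fun x => on_edge f e x * conjc (on_edge g e x)).

Definition L2norm f : R := Num.sqrt (complex.Re (inner f f)).

Definition ae_zero f : Prop :=
  forall e, {ae mu, forall x, 0 <= x <= len e -> on_edge f e x = 0}.

Definition graph_continuous f : Prop := forall e,
  [/\ continuous_interval (len e) (on_edge f e),
      on_edge f e 0 = f (inl (src e)) &
      on_edge f e (len e) = f (inl (tgt e))].

Definition H1 f : Prop :=
  graph_continuous f /\ forall e, H1_interval (len e) (on_edge f e).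

Definition robin_form (VR : {set vertex G}) (alpha : R) f g : R[i] :=
  \sum_(e : edge G)
    cintegral (len e) (fun x => wderiv (len e) (on_edge f e) x *
                                conjc (wderiv (len e) (on_edge g e) x))
  + alpha%:C%C * \sum_(v in VR) f (inl v) * conjc (g (inl v)).

(* The graph of the operator associated with the form: robin_laplacian f w
   means that f is in the domain and is mapped to w.  The image w is
   determined up to null sets, H1 being dense in L2. *)
Definition robin_laplacian (VR : {set vertex G}) (alpha : R) f w : Prop :=
  [/\ H1 f, L2 w & forall g, H1 g -> robin_form VR alpha f g = inner w g].

(* z is in the resolvent set of A when A - z is a bijection from the domain
   onto L2 with bounded inverse; "A u = h + z u" reads (A - z) u = h. *)
Definition resolvent_set (A : graph_fun G -> graph_fun G -> Prop) : set R[i] :=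
  [set z |
    (forall u, A u (fun p => z * u p) -> ae_zero u) /\
    exists C : R, forall h, L2 h ->
      exists2 u, A u (fun p => h p + z * u p) & L2norm u <= C * L2norm h].

Definition spectrum (A : graph_fun G -> graph_fun G -> Prop) : set R[i] :=
  ~` resolvent_set A.

(* All of the spectrum when A is the Robin Laplacian, which is self-adjoint. *)
Definition real_spectrum (A : graph_fun G -> graph_fun G -> Prop) : set R :=
  [set x | spectrum A x%:C%C].

End RobinLaplacian.

(* Main.v *)
Require Import Defs.
From HB Require Import structures.
From mathcomp Require Import all_boot all_order all_algebra.
From mathcomp Require Import complex.
From mathcomp Require Import all_classical all_reals all_analysis.
From mathcomp Require Import measurable_realfun.
From mathcomp Require Import ring lra.
Import Order.TTheory GRing.Theory Num.Theory.
Import numFieldNormedType.Exports.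
Set Implicit Arguments.
Unset Strict Implicit.
Unset Printing Implicit Defensive.
Local Open Scope classical_set_scope.
Local Open Scope ring_scope.

(** Let [m] be the supremum of the [z] with
    [a(f, f) >= z |f|^2] on [H1].  If [m] were in the resolvent set, solving
    [(A - m) u = f] and inserting [f - t u] into [a - m >= 0] would give
    [a(f, f) >= (m + d) |f|^2] for some [d > 0], against the choice of [m].
    So [m] is in the spectrum and [lambda1] is below every Rayleigh quotient.
    That [m] exists is the trace inequality
    [|f(0)|^2 <= 2 s |f'|^2 + (32 / s) |f|^2], obtained by testing the weak
    derivative against differences of C^1 ramps.

    The bound [k alpha / |G|] is the Rayleigh quotient of the constant 1.  For
    the other one, put [w = - alpha / D - 1 / l] and choose [v] of degree [D]:
    on the edges at [v] use [(1 - x / L) exp (- w x)], for which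
    [int f'^2 + w^2 f^2 <= w + 1 / L], and on loops at [v] a multiple of
    [cosh (w (x - L / 2))], for which this integral is at most [2 w].  Summing
    over the edges, [a(f, f) + w^2 |f|^2 <= D (w + 1 / l) + alpha = 0]. *)

(** * Weak derivatives on an interval *)

Section Calculus.
Context {R : realType}.
Local Notation mu := (@lebesgue_measure R).
Implicit Types (F f : R -> R) (l : R).

(** The derivative is carried as an explicit function, so that the closure lemmas compute
    derivatives by composing terms. Differentiability is required on the whole line, which avoids
    one-sided derivatives at the ends of an edge. *)
Definition has_C1_derivative F f : Prop :=
  (forall x : R, is_derive x 1 F (f x)) /\ continuous f.

Lemma C1_continuous F f : has_C1_derivative F f -> continuous F.
Proof.
move=> [dF _] x; apply: differentiable_continuous; apply/derivable1_diffP.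
by have [] := dF x.
Qed.

Lemma C1_derive1 F f : has_C1_derivative F f -> derive1 F = f.
Proof.
move=> [dF _]; apply/funext => x; rewrite derive1E.
by have dFx := dF x; rewrite derive_val.
Qed.

Lemma C1_comp F f G g : has_C1_derivative F f -> has_C1_derivative G g ->
  has_C1_derivative (F \o G) (fun x => f (G x) * g x).
Proof.
move=> C1F C1G; split=> x.
  have dF := C1F.1 (G x); have dG := C1G.1 x.
  by apply: is_derive_eq; rewrite /GRing.scale/= mulrC.
apply: cvgM; last exact: C1G.2.
apply: (@continuous_comp _ _ _ G f); [exact: (C1_continuous C1G)|exact: C1F.2].
Qed.

Lemma C1_mul F f G g : has_C1_derivative F f -> has_C1_derivative G g ->
  has_C1_derivative (fun x => F x * G x) (fun x => F x * g x + G x * f x).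
Proof.
move=> C1F C1G; split=> x.
  have dF := C1F.1 x; have dG := C1G.1 x; exact: is_derive_eq.
by apply: cvgD; apply: cvgM; do 1?[exact: C1F.2|exact: C1G.2
  |exact: (C1_continuous C1F)|exact: (C1_continuous C1G)].
Qed.

Lemma C1_add F f G g : has_C1_derivative F f -> has_C1_derivative G g ->
  has_C1_derivative (fun x => F x + G x) (fun x => f x + g x).
Proof.
move=> C1F C1G; split=> x.
  have dF := C1F.1 x; have dG := C1G.1 x; exact: is_derive_eq.
by apply: cvgD; [exact: C1F.2|exact: C1G.2].
Qed.

Lemma C1_scale (c : R) F f : has_C1_derivative F f ->
  has_C1_derivative (fun x => c * F x) (fun x => c * f x).
Proof.
move=> C1F; split=> x.
  by have dF := C1F.1 x; apply: is_derive_eq.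
by apply: (@cvgM _ _ _ _ (fun=> c) f); [exact: cvg_cst|exact: C1F.2].
Qed.

Lemma C1_affine (a b : R) : has_C1_derivative (fun x => a * x + b) (fun=> a).
Proof.
split=> x; last exact: cvg_cst.
by apply: is_derive_eq; rewrite /GRing.scale/= mulr1 addr0.
Qed.

Lemma C1_expR : has_C1_derivative (@expR R) (@expR R).
Proof. by split=> x; [exact: is_derive_expR|exact: continuous_expR]. Qed.

Lemma integrable_continuous F l : {within `[0, l], continuous F} ->
  mu.-integrable `[0, l] (EFin \o F).
Proof. by apply: continuous_compact_integrable; exact: segment_compact. Qed.

Lemma Rintegral_C1 F f l : 0 < l -> has_C1_derivative F f ->
  \int[mu]_(x in `[0, l]) f x = F l - F 0.
Proof.
move=> l0 C1F; rewrite /Rintegral (@continuous_FTC2 _ f F)//.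
- by apply: continuous_subspaceT; exact: C1F.2.
- split=> [x _| |]; first by have [] := C1F.1 x.
  + by apply: cvg_at_right_filter; exact: (C1_continuous C1F).
  + by apply: cvg_at_left_filter; exact: (C1_continuous C1F).
- by move=> x _; rewrite (C1_derive1 C1F).
Qed.

(** * Smooth ramps as test functions *)

Definition sqr_pos (t : R) : R := Num.max 0 t ^+ 2.

(** The error of the first-order expansion is at most [h ^+ 2] whatever the signs of [x] and
    [h + x]; this treats the kink of the derivative at 0 together with all other points. *)
Lemma C1_sqr_pos : has_C1_derivative sqr_pos (fun t => 2 * Num.max 0 t).
Proof.
split=> x; last first.
  apply: cvgM; first exact: cvg_cst.
  apply: (@continuous_max _ _ (fun=> 0) id); [exact: cvg_cst|exact: cvg_id].
suff cv : (h^-1 *: (sqr_pos (h *: 1 + x) - sqr_pos x)) @[h --> 0^']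
    --> 2 * Num.max 0 x.
  by split; [apply/cvg_ex; exists (2 * Num.max 0 x)|exact: cvg_lim cv].
apply/cvgrPdist_le => /= e e0; near=> h.
have h0 : h != 0 by near: h; exact: nbhs_dnbhs_neq.
have he : `|h| <= e.
  near: h; apply: nbhs_dnbhs.
  by apply: (@cvgr0_norm_le _ _ _ (nbhs (0:R)) _ id); [exact: cvg_id|].
rewrite (_ : _ - _ = h^-1 * (2 * Num.max 0 x * h - (sqr_pos (h + x) - sqr_pos x))); last first.
  by rewrite /GRing.scale/= mulr1; field.
rewrite normrM normfV mulrC ler_pdivrMr ?normr_gt0//.
apply: (@le_trans _ _ (`|h| * `|h|)); last by rewrite ler_wpM2r.
rewrite -normrM -expr2 (ger0_norm (sqr_ge0 h)).
rewrite /sqr_pos ler_norml; apply/andP; split;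
case: (leP 0 x) => x0; case: (leP 0 (h + x)) => hx0; rewrite ?expr0n/=; nra.
Unshelve. all: by end_near.
Qed.

(* The derivative of [unit_ramp] is the hat function of height 2 on [0, 1]. *)
Definition unit_ramp (t : R) : R :=
  2 * sqr_pos t - 4 * sqr_pos (t - 1 / 2) + 2 * sqr_pos (t - 1).

Definition dunit_ramp (t : R) : R :=
  4 * Num.max 0 t - 8 * Num.max 0 (t - 1 / 2) + 4 * Num.max 0 (t - 1).

Definition ramp (a d x : R) : R := unit_ramp ((x - a) / d).

Definition dramp (a d x : R) : R := dunit_ramp ((x - a) / d) / d.

Lemma C1_unit_ramp : has_C1_derivative unit_ramp dunit_ramp.
Proof.
have shift (c : R) : has_C1_derivative (fun t => sqr_pos (t - c))
    (fun t => 2 * Num.max 0 (t - c)).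
  have := C1_comp C1_sqr_pos (C1_affine 1 (- c)).
  rewrite (_ : (_ \o _) = fun t => sqr_pos (t - c)); last first.
    by apply/funext => t /=; rewrite mul1r.
  rewrite (_ : (fun x => _ * 1) = fun t => 2 * Num.max 0 (t - c))//.
  by apply/funext => t /=; rewrite mul1r mulr1.
have := C1_add (C1_add (C1_scale 2 C1_sqr_pos) (C1_scale (- 4) (shift (1 / 2))))
  (C1_scale 2 (shift 1)).
rewrite (_ : (fun x => _ + 2 * sqr_pos _) = unit_ramp); last first.
  by apply/funext => t; rewrite /unit_ramp; ring.
rewrite (_ : (fun x => _ + _) = dunit_ramp)//.
by apply/funext => t; rewrite /dunit_ramp; ring.
Qed.

Lemma C1_ramp a d : has_C1_derivative (ramp a d) (dramp a d).
Proof.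
have := C1_comp C1_unit_ramp (C1_affine d^-1 (- (a / d))).
rewrite (_ : (_ \o _) = ramp a d); last first.
  by apply/funext => t /=; rewrite /ramp; congr unit_ramp; ring.
rewrite (_ : (fun x => _) = dramp a d)//.
by apply/funext => t /=; rewrite /dramp; congr (dunit_ramp _ / d); ring.
Qed.

Lemma unit_ramp_bound t : 0 <= unit_ramp t <= 1.
Proof.
rewrite /unit_ramp /sqr_pos; case: (leP 0 t) => ?; case: (leP 0 (t - 1 / 2)) => ?;
case: (leP 0 (t - 1)) => ?; rewrite ?expr0n/=; apply/andP; split; nra.
Qed.

Lemma dunit_ramp_bound t : 0 <= dunit_ramp t <= 2.
Proof.
rewrite /dunit_ramp; case: (leP 0 t) => ?; case: (leP 0 (t - 1 / 2)) => ?;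
case: (leP 0 (t - 1)) => ?; apply/andP; split; lra.
Qed.

Lemma unit_ramp0 t : t <= 0 -> unit_ramp t = 0.
Proof.
by move=> t0; rewrite /unit_ramp /sqr_pos !max_l; [ring|lra..].
Qed.

Lemma unit_ramp1 t : 1 <= t -> unit_ramp t = 1.
Proof.
by move=> t0; rewrite /unit_ramp /sqr_pos !max_r; [field|lra..].
Qed.

Lemma dunit_ramp_out t : ~~ (0 <= t <= 1) -> dunit_ramp t = 0.
Proof.
rewrite negb_and -!ltNge /dunit_ramp => /orP[t0|t1].
  by rewrite !max_l; [ring|lra..].
by rewrite !max_r; [field|lra..].
Qed.

Lemma ramp_bound a d x : 0 <= ramp a d x <= 1.
Proof. exact: unit_ramp_bound. Qed.

Lemma ramp0 a d x : 0 < d -> x <= a -> ramp a d x = 0.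
Proof. by move=> d0 xa; rewrite /ramp unit_ramp0// ler_pdivrMr//; lra. Qed.

Lemma ramp1 a d x : 0 < d -> a + d <= x -> ramp a d x = 1.
Proof. by move=> d0 xa; rewrite /ramp unit_ramp1// ler_pdivlMr//; lra. Qed.

Lemma dramp_ge0 a d x : 0 < d -> 0 <= dramp a d x.
Proof.
move=> d0; have /andP[h _] := dunit_ramp_bound ((x - a) / d).
by rewrite /dramp divr_ge0// ltW.
Qed.

Lemma dramp_le a d x : 0 < d -> dramp a d x <= 2 / d.
Proof.
move=> d0; have /andP[_ h] := dunit_ramp_bound ((x - a) / d).
by rewrite /dramp ler_wpM2r// invr_ge0 ltW.
Qed.

Lemma dramp_out a d x : 0 < d -> ~~ (a <= x <= a + d) -> dramp a d x = 0.
Proof.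
move=> d0 h; rewrite /dramp dunit_ramp_out ?mul0r//.
apply: contra h; rewrite ler_pdivrMr// ler_pdivlMr// => /andP[? ?].
by apply/andP; split; lra.
Qed.

Lemma test_function_C1 l phi dphi a b : has_C1_derivative phi dphi ->
  0 < a -> b < l -> (forall x, phi x != 0 -> a <= x <= b) ->
  test_function l phi.
Proof.
move=> C1p a0 bl h; split.
- by move=> x; have [] := C1p.1 x.
- by rewrite (C1_derive1 C1p); exact: C1p.2.
- by exists a, b; split.
Qed.

(* As test functions, differences of ramps suffice both for uniqueness of weak
   derivatives and for the trace inequality. *)
Definition ramp_diff (a d b e x : R) := ramp a d x - ramp b e x.

Definition dramp_diff (a d b e x : R) := dramp a d x - dramp b e x.

Lemma C1_ramp_diff a d b e :
  has_C1_derivative (ramp_diff a d b e) (dramp_diff a d b e).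
Proof.
have := C1_add (C1_ramp a d) (C1_scale (-1) (C1_ramp b e)).
rewrite (_ : (fun x => _ + _ * ramp _ _ _) = ramp_diff a d b e); last first.
  by apply/funext => t; rewrite mulN1r.
rewrite (_ : (fun x => _) = dramp_diff a d b e)//.
by apply/funext => t; rewrite mulN1r.
Qed.

(** Both ramps vanish to the left of their rises and equal 1 to the right, so the difference has
    compact support although neither ramp does. *)
Lemma test_ramp_diff l a d b e : 0 < d -> 0 < e ->
  0 < a -> 0 < b -> a + d < l -> b + e < l ->
  test_function l (ramp_diff a d b e).
Proof.
move=> d0 e0 a0 b0 al bl.
apply: (@test_function_C1 _ _ _ (Num.min a b) (Num.max (a + d) (b + e))
  (C1_ramp_diff a d b e)).
- by rewrite lt_min a0 b0.
- by rewrite gt_max al bl.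
- move=> x; rewrite ge_min le_max; apply: contraNT.
  rewrite negb_and !negb_or -!ltNge /ramp_diff => /orP[]/andP[h1 h2].
    by rewrite !ramp0 ?subrr// ltW.
  by rewrite !ramp1 ?subrr// ltW.
Qed.

Lemma ramp_diff_norm a d b e x : `|ramp_diff a d b e x| <= 1.
Proof.
have /andP[? ?] := ramp_bound a d x; have /andP[? ?] := ramp_bound b e x.
by rewrite /ramp_diff ler_norml; apply/andP; split; lra.
Qed.

(** * Square-integrable functions and real weak derivatives *)

Definition sq_integrable l f : Prop :=
  measurable_fun `[0, l] f /\ mu.-integrable `[0, l] (EFin \o (fun x => f x ^+ 2)).

Lemma sq_integrableM l f g : sq_integrable l f -> sq_integrable l g ->
  mu.-integrable `[0, l] (EFin \o (fun x => f x * g x)).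
Proof.
move=> [mf if2] [mg ig2].
apply: (@le_integrable _ _ _ mu _ _ _ (EFin \o (fun x => f x ^+ 2 + g x ^+ 2))) => //.
- by apply/measurable_EFinP; exact: measurable_funM.
- move=> x _ /=; rewrite lee_fin [leRHS]ger0_norm ?addr_ge0 ?sqr_ge0// ler_norml.
  by apply/andP; split; nra.
- exact: (integrableD _ if2 ig2).
Qed.

Lemma sq_integrableZ l c f : sq_integrable l f ->
  sq_integrable l (fun x => c * f x).
Proof.
move=> [mf if2]; split; first exact: measurable_funM.
rewrite (_ : _ \o _ = fun x => ((c ^+ 2)%:E * (f x ^+ 2)%:E)%E); last first.
  by apply/funext => x /=; rewrite exprMn EFinM.
exact: integrableZl.
Qed.

Lemma sq_integrableD l f g : sq_integrable l f -> sq_integrable l g ->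
  sq_integrable l (fun x => f x + g x).
Proof.
move=> f2 g2; have fg := sq_integrableM f2 g2.
case: f2 g2 => [mf if2] [mg ig2]; split; first exact: measurable_funD.
rewrite (_ : (fun x => _) = fun x => (f x ^+ 2 + g x ^+ 2) + (f x * g x + f x * g x)).
  exact: (integrableD _ (integrableD _ if2 ig2) (integrableD _ fg fg)).
by apply/funext => x; ring.
Qed.

Lemma sq_integrable_continuous l f : {within `[0, l], continuous f} ->
  sq_integrable l f.
Proof.
move=> cf; split; first exact: subspace_continuous_measurable_fun.
by apply: integrable_continuous => x; apply: cvgM; exact: cf.
Qed.

Lemma C1_within F f l : has_C1_derivative F f -> {within `[0, l], continuous F}.
Proof. by move=> C1F; apply: continuous_subspaceT; exact: C1_continuous C1F. Qed.

Definition real_weak_derivative l f g : Prop :=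
  forall phi, test_function l phi ->
    \int[mu]_(x in `[0, l]) (f x * derive1 phi x) =
    - \int[mu]_(x in `[0, l]) (g x * phi x).

Lemma sq_integrable_C1 l F f : has_C1_derivative F f -> sq_integrable l F.
Proof. by move=> h; apply: sq_integrable_continuous; exact: C1_within h. Qed.

Lemma sq_integrable_dC1 l F f : has_C1_derivative F f -> sq_integrable l f.
Proof.
by move=> h; apply/sq_integrable_continuous/continuous_subspaceT => x; exact: h.2.
Qed.

Lemma test_function_has_C1 l phi : test_function l phi ->
  has_C1_derivative phi (derive1 phi).
Proof.
by case=> d c _; split => // x; rewrite derive1E; exact/derivableP.
Qed.

(** Integration by parts: the derivative of [F * phi] has integral 0, because [phi] vanishes at both
    ends of the interval. *)
Lemma C1_weak_derivative l F f : 0 < l -> has_C1_derivative F f ->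
  real_weak_derivative l F f.
Proof.
move=> l0 C1F phi tphi; have C1p := test_function_has_C1 tphi.
have := Rintegral_C1 l0 (C1_mul C1F C1p).
have [_ _ [a [b [a0 bl supp]]]] := tphi.
have -> : phi l = 0.
  by apply/eqP; apply: contraT => /supp /andP[_ lb]; lra.
have -> : phi 0 = 0.
  by apply/eqP; apply: contraT => /supp /andP[a0' _]; lra.
rewrite !mulr0 subrr RintegralD//; first last.
- by apply: sq_integrableM; [exact: sq_integrable_C1 C1p|exact: sq_integrable_dC1 C1F].
- by apply: sq_integrableM; [exact: sq_integrable_C1 C1F|exact: sq_integrable_dC1 C1p].
move=> /eqP; rewrite addr_eq0 => /eqP ->; congr (- _).
by apply: eq_Rintegral => x _; rewrite mulrC.
Qed.

Lemma real_weak_derivativeD l f1 f2 g1 g2 :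
  sq_integrable l f1 -> sq_integrable l g1 ->
  sq_integrable l f2 -> sq_integrable l g2 ->
  real_weak_derivative l f1 g1 -> real_weak_derivative l f2 g2 ->
  real_weak_derivative l (fun x => f1 x + f2 x) (fun x => g1 x + g2 x).
Proof.
move=> if1 ig1 if2 ig2 w1 w2 phi tphi; have C1p := test_function_has_C1 tphi.
have p2 := sq_integrable_C1 l C1p; have dp2 := sq_integrable_dC1 l C1p.
under eq_Rintegral do rewrite mulrDl.
under [in RHS]eq_Rintegral do rewrite mulrDl.
by rewrite !RintegralD ?opprD -?w1 -?w2//; exact: sq_integrableM.
Qed.

Lemma real_weak_derivativeZ l c f g :
  sq_integrable l f -> sq_integrable l g ->
  real_weak_derivative l f g ->
  real_weak_derivative l (fun x => c * f x) (fun x => c * g x).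
Proof.
move=> if1 ig1 w1 phi tphi; have C1p := test_function_has_C1 tphi.
have p2 := sq_integrable_C1 l C1p; have dp2 := sq_integrable_dC1 l C1p.
under eq_Rintegral do rewrite -mulrA.
under [in RHS]eq_Rintegral do rewrite -mulrA.
by rewrite !RintegralZl ?w1 ?mulrN//; exact: sq_integrableM.
Qed.

Lemma sq_integrable_integrable l f : sq_integrable l f ->
  mu.-integrable `[0, l] (EFin \o f).
Proof.
move=> f2; have c1 : sq_integrable l (fun=> 1).
  by apply: (@sq_integrable_dC1 l (fun x => 1 * x + 0)); exact: C1_affine.
rewrite (_ : f = fun x => f x * 1); first exact: sq_integrableM.
by apply/funext => x; rewrite mulr1.
Qed.

(** * Almost everywhere uniqueness of weak derivatives *)

Lemma EFin_Rintegral D f : measurable D -> mu.-integrable D (EFin \o f) ->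
  ((\int[mu]_(x in D) f x)%:E = \int[mu]_(x in D) (f x)%:E)%E.
Proof. by move=> mD intf; rewrite fineK//; exact: integrable_fin_num. Qed.

(** The first ramp rises on [[e n, 2 * e n]], which shrinks towards 0, the second on [[b, b + e n]],
    which shrinks towards [b] from the right. This is why the limit excludes 0 and includes [b].
    Taking [e n] at most a quarter of [b] and of [l - b] keeps both rises inside []0, l[]. *)
Lemma ramp_diff_cvg_indic (b l : R) : 0 < b < l ->
  exists e : nat -> R,
    (forall n, test_function l (ramp_diff (e n) (e n) b (e n))) /\
    forall x : R, 0 <= x -> \forall n \near \oo,
      ramp_diff (e n) (e n) b (e n) x = \1_(`]0, b]%classic) x.
Proof.
move=> /andP[b0 bl]; pose r := Num.min b (l - b) / 4.
have r0 : 0 < r by rewrite divr_gt0// lt_min b0 subr_gt0.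
have rb : 4 * r <= b by rewrite /r mulrC divfK// ge_min lexx.
have rl : 4 * r <= l - b by rewrite /r mulrC divfK// ge_min lexx orbT.
clearbody r; pose e (n : nat) : R := r / n.+1%:R.
have e0 n : 0 < e n by rewrite divr_gt0.
have er n : e n <= r.
  by rewrite /e ler_pdivrMr// ler_peMr ?ler1n// ltW.
have ecvg (d : R) : 0 < d -> \forall n \near \oo, 2 * e n <= d.
  move=> d0; have /cvgrPdist_le : (2 * r) *: @harmonic R n @[n --> \oo] --> (2 * r) *: 0.
    by apply: cvgZr; exact: cvg_harmonic.
  move=> /(_ d d0); apply: filterS => n.
  rewrite scaler0 sub0r normrN ger0_norm /GRing.scale/= /harmonic.
    by rewrite /e mulrA.
  by rewrite divr_ge0// mulr_ge0// ltW.
exists e; split=> [n|x x0].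
  have := e0 n; have := er n => ? ?.
  by apply: test_ramp_diff => //; lra.
have [->|xn0] := eqVneq x 0.
  near=> n; rewrite /ramp_diff !ramp0 ?subrr ?indicE//.
  - by rewrite memNset// /= in_itv/= ltxx.
  - exact: ltW.
  - by have := e0 n; lra.
have {x0}xn0 : 0 < x by rewrite lt_def xn0.
have [xb|bx] := leP x b.
  near=> n; have h : 2 * e n <= x by near: n; exact: ecvg.
  rewrite /ramp_diff ramp1 ?ramp0 ?subr0 ?indicE//; last lra.
  by rewrite mem_set//= in_itv/= xn0 xb.
near=> n; have h : 2 * e n <= x by near: n; exact: ecvg.
have h' : 2 * e n <= x - b by near: n; apply: ecvg; lra.
have := e0 n => en0.
rewrite /ramp_diff !ramp1 ?subrr ?indicE//; [|lra..].
by rewrite memNset//= in_itv/= xn0/= leNgt bx.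
Unshelve. all: by end_near.
Qed.

(** Dominated convergence along test functions tending to the indicator of []0, b]]; they are
    bounded by 1, so [|f|] is a majorant. *)
Lemma Rintegral_initial_eq0 l f b : sq_integrable l f ->
  (forall phi, test_function l phi ->
     \int[mu]_(x in `[0, l]) (f x * phi x) = 0) ->
  0 < b < l -> \int[mu]_(x in `]0, b]) f x = 0.
Proof.
move=> f2 f0 b0l; have [e [te ecvg]] := ramp_diff_cvg_indic b0l.
move: b0l => /andP[b0 bl].
pose phi n := ramp_diff (e n) (e n) b (e n).
have mphi n : measurable_fun `[0, l] (phi n).
  by have [] := sq_integrable_C1 l (C1_ramp_diff (e n) (e n) b (e n)).
have intf := sq_integrable_integrable f2.
have mind : measurable_fun `[0, l] (\1_(`]0, b]%classic) : R -> R).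
  exact: measurable_indic.
have [|||||_ _] := @dominated_convergence _ _ _ mu `[0, l] (measurable_itv _)
  (fun n x => (f x * phi n x)%:E) (fun x => (f x * \1_(`]0, b]%classic) x)%:E)
  (fun x => `|f x|%:E).
- by move=> n; apply/measurable_EFinP; exact: (measurable_funM f2.1 (mphi n)).
- by apply/measurable_EFinP; exact: (measurable_funM f2.1 mind).
- apply: aeW => x /=; rewrite in_itv/= => /andP[x0 _].
  apply: cvg_near_cst; apply: filterS (ecvg x x0) => n.
  by rewrite /phi => ->.
- exact: integrable_norm intf.
- apply: aeW => x n _; rewrite /= lee_fin normrM.
  by rewrite ler_piMr// ramp_diff_norm.
have -> : [sequence (\int[mu]_(x in `[0%R, l]) (f x * phi n x)%:E)%E]_n = cst 0%E.
  apply/funext => n /=; rewrite -EFin_Rintegral//.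
    by rewrite (f0 _ (te n)).
  apply: sq_integrableM => //.
  exact: sq_integrable_C1 (C1_ramp_diff (e n) (e n) b (e n)).
move=> cv.
have int0 : (\int[mu]_(x in `[0%R, l]) (f x * \1_(`]0%R, b]%classic) x)%:E = 0)%E.
  by apply: (cvg_unique _ cv); [exact: ereal_hausdorff|exact: cvg_cst].
rewrite (_ : `]0, b]%classic = `[0, l]%classic `&` `]0, b]%classic); last first.
  apply/seteqP; split=> x /=; rewrite !in_itv/=; last by case.
  by move=> /andP[x0 xb]; split; apply/andP; split; lra.
rewrite Rintegral_mkcondr /Rintegral.
rewrite (_ : (\int[mu]_(x in `[0%R, l]) _)%E = 0%E)//.
rewrite -[RHS]int0; apply: eq_integral => x _; congr EFin.
by rewrite patchE indicE; case: ifP => _; rewrite ?mulr1 ?mulr0.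
Qed.

(** The primitive of [f] vanishes on []0, l[], and by Lebesgue differentiation its derivative is [f]
    almost everywhere. *)
Lemma ae_eq0_of_test_functions l f : sq_integrable l f ->
  (forall phi, test_function l phi ->
     \int[mu]_(x in `[0, l]) (f x * phi x) = 0) ->
  {ae mu, forall x, `[0, l]%classic x -> f x = 0}.
Proof.
move=> f2 f0; have intf := sq_integrable_integrable f2.
(* Extension by zero gives a locally integrable function on the whole line, as the differentiation
   theorem [FTC1] demands. *)
pose g := f \_ (`[0, l]%classic).
have intg y : mu.-integrable [set` Interval (BRight 0) (BRight y)] (EFin \o g).
  apply: (@integrableS _ _ _ mu setT) => //.
  by rewrite /g -restrict_EFin; apply/integrable_restrict => //; rewrite setTI.
have locg := integrable_locally (measurable_itv _) intf.
have := FTC1 intg locg.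
(* The two endpoints are discarded as null sets: the primitive is known to vanish for upper limits
   strictly between 0 and [l], and these fill a neighbourhood of [x] only when [x] is interior. *)
have ne (c : R) : {ae mu, forall x, x != c}.
  exists [set c]; split => //; first exact: lebesgue_measure_set1.
  by move=> x /= /negP; rewrite negbK => /eqP.
move=> ftc; have aeF := ae_filter_ringOfSetsType mu.
apply: filterS3 (ne 0) (ne l) ftc => x xn0 xnl h /=; rewrite in_itv/= => /andP[x0 xl].
have {x0}x0 : 0 < x by rewrite lt_def xn0.
have {xl}xl : x < l by rewrite lt_def eq_sym xnl.
have [_] := h x0.
have gx : g x = f x by rewrite /g patchE mem_set//= in_itv/= !ltW.
rewrite gx => <-.
rewrite derive1E; transitivity ('D_1 (fun=> 0 : R) x); last exact: derive_cst.
apply: near_eq_derive.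
near=> y.
have y0 : 0 < y by near: y; exact: lt_nbhsr.
have yl : y < l by near: y; exact: lt_nbhsl.
rewrite -[RHS](Rintegral_initial_eq0 f2 f0 (b := y)) ?y0//.
apply: eq_Rintegral => z; rewrite inE/= in_itv/= => /andP[z0 zy].
by rewrite /g patchE mem_set//= in_itv/= ltW//= (le_trans zy)// ltW.
Unshelve. all: by end_near.
Qed.

Lemma integrable_scale D (c : R) f : measurable D -> mu.-integrable D (EFin \o f) ->
  mu.-integrable D (EFin \o (fun x => c * f x)).
Proof. by move=> mD intf; exact: (integrableZl mD c intf). Qed.

Lemma integrable_add D f g : measurable D -> mu.-integrable D (EFin \o f) ->
  mu.-integrable D (EFin \o g) -> mu.-integrable D (EFin \o (fun x => f x + g x)).
Proof. by move=> mD intf intg; exact: (integrableD mD intf intg). Qed.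

Lemma real_weak_derivative_unique l f g1 g2 :
  sq_integrable l g1 -> sq_integrable l g2 ->
  real_weak_derivative l f g1 -> real_weak_derivative l f g2 ->
  {ae mu, forall x, `[0, l]%classic x -> g1 x = g2 x}.
Proof.
move=> i1 i2 w1 w2.
have aeF := ae_filter_ringOfSetsType mu.
have i12 : sq_integrable l (fun x => g1 x + (-1) * g2 x).
  by apply: sq_integrableD => //; exact: sq_integrableZ.
apply: filterS (ae_eq0_of_test_functions i12 _) => [x /[apply]|phi tphi].
  by move/eqP; rewrite mulN1r subr_eq0 => /eqP.
have p2 := sq_integrable_C1 l (test_function_has_C1 tphi).
under eq_Rintegral do rewrite mulrDl -mulrA.
rewrite RintegralD ?RintegralZl//; [|exact: sq_integrableM..|].
  by apply: oppr_inj; rewrite oppr0 mulN1r opprD opprK -w1// w2// addNr.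
by apply: integrable_scale => //; exact: sq_integrableM.
Qed.

(** * The trace inequality *)

Lemma integrable_indic_segment (l c d : R) :
  mu.-integrable `[0, l] (EFin \o (\1_(`[c, d]%classic) : R -> R)).
Proof.
apply: (@le_integrable _ _ _ mu _ (measurable_itv _) _ (EFin \o (fun=> 1 : R))).
- by apply/measurable_EFinP; apply: measurable_indic; exact: measurable_itv.
- by move=> t _ /=; rewrite lee_fin indicE normr1; case: (_ \in _); rewrite ?normr1 ?normr0.
- by apply: integrable_continuous => x; exact: cvg_cst.
Qed.

Lemma Rintegral_indic_segment (l c k : R) : 0 <= c -> 0 < k -> c + k <= l ->
  \int[mu]_(x in `[0, l]) (\1_(`[c, c + k]%classic) x) = k.
Proof.
move=> c0 k0 ckl; rewrite /Rintegral integral_indic//.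
rewrite (_ : _ `&` _ = `[c, c + k]%classic); last first.
  apply/seteqP; split=> x; first by case.
  by move=> Kx; split=> //; move: Kx; rewrite /= !in_itv/= => /andP[? ?]; lra.
suff h : fine (mu `[c, c + k]%classic) = k by exact: h.
rewrite lebesgue_measure_itv/= lte_fin ifT ?ltrDl//=.
by rewrite addrAC subrr add0r.
Qed.

(* Test against a steep ramp placed where f is close to y, minus a ramp of
   slope of order 1 / k in the middle of [c, c + k]; both terms of the resulting
   linear bound on y are then split by AM-GM. *)
Lemma trace_one_sided l c k y f g : 0 <= c -> 0 < k -> c + k <= l ->
  sq_integrable l f -> sq_integrable l g -> real_weak_derivative l f g ->
  0 <= y ->
  (forall eta : R, 0 < eta -> exists a d : R, [/\ 0 < d, c < a, a + d < c + k &
     forall x : R, a <= x <= a + d -> y - eta <= f x]) ->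
  y ^+ 2 <= 2 * k * \int[mu]_(x in `[0, l]) (g x ^+ 2)
           + 32 / k * \int[mu]_(x in `[0, l]) (f x ^+ 2).
Proof.
move=> c0 k0 ckl f2 g2 wfg y0 fy.
have l0 : 0 < l by lra.
set Ig := \int[mu]_(x in _) (g x ^+ 2); set If := \int[mu]_(x in _) (f x ^+ 2).
pose K : set R := `[c, c + k]%classic.
have intK : mu.-integrable `[0, l] (EFin \o (\1_K : R -> R)).
  exact: integrable_indic_segment.
have IK : \int[mu]_(x in `[0, l]) (\1_K x) = k by exact: Rintegral_indic_segment.
have main (eta : R) : 0 < eta ->
    y * (y - eta) <= y ^+ 2 / 2 + k * Ig + 16 / k * If.
  move=> /fy[a [d [d0 ca adk fa]]].
  (* The second ramp rises on the middle half of [[c, c + k]], and its slope is at most [2 / e],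
     that is [4 / k]. *)
  pose b := c + k / 4; pose e := k / 2.
  have e0 : 0 < e by rewrite divr_gt0.
  have be : b + e < c + k by rewrite /b /e; lra.
  have cb : c < b by rewrite /b; lra.
  have tphi : test_function l (ramp_diff a d b e).
    by apply: test_ramp_diff => //; lra.
  have C1a := C1_ramp a d; have C1b := C1_ramp b e.
  have C1ab := C1_ramp_diff a d b e.
  have := wfg _ tphi; rewrite (C1_derive1 C1ab).
  have intfa : mu.-integrable `[0, l] (EFin \o (fun x => f x * dramp a d x)).
    by apply: sq_integrableM => //; exact: sq_integrable_dC1 C1a.
  have intfb : mu.-integrable `[0, l] (EFin \o (fun x => f x * dramp b e x)).
    by apply: sq_integrableM => //; exact: sq_integrable_dC1 C1b.
  have intg : mu.-integrable `[0, l] (EFin \o (fun x => g x * ramp_diff a d b e x)).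
    by apply: sq_integrableM => //; exact: sq_integrable_C1 C1ab.
  under eq_Rintegral do rewrite mulrBr.
  rewrite RintegralB// => /eqP; rewrite subr_eq addrC => /eqP key.
  (* The function [dramp a d] is a nonnegative weight of integral 1 living on [[a, a + d]], so the
     integral is an average of values that are at least [y - eta]. *)
  have low : (y - eta) <= \int[mu]_(x in `[0, l]) (f x * dramp a d x).
    have -> : y - eta = \int[mu]_(x in `[0, l]) ((y - eta) * dramp a d x).
      rewrite RintegralZl//; last first.
        exact: sq_integrable_integrable (sq_integrable_dC1 l C1a).
      rewrite (Rintegral_C1 l0 C1a) ramp1 ?ramp0 ?subr0 ?mulr1//; lra.
    apply: le_Rintegral => //.
      exact: sq_integrable_integrable (sq_integrableZ _ (sq_integrable_dC1 l C1a)).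
    move=> x _; have [xa|xa] := boolP (a <= x <= a + d).
      by rewrite ler_wpM2r ?dramp_ge0// fa.
    by rewrite dramp_out// !mulr0.
  apply: (le_trans (ler_wpM2l y0 low)); rewrite key -mulN1r -RintegralZl//.
  rewrite -RintegralD//; last exact: integrable_scale.
  rewrite -RintegralZl//; last by apply: integrable_add => //; exact: integrable_scale.
  have intf2 := f2.2; have intg2 := g2.2.
  have intkg := integrable_scale k (measurable_itv _) intg2.
  have intkf := integrable_scale (16 / k) (measurable_itv _) intf2.
  have intky := integrable_scale (y ^+ 2 / (2 * k)) (measurable_itv _) intK.
  have intr := integrable_add (measurable_itv _) intkg intkf.
  (* Spreading the constant [y ^+ 2 / 2] evenly over the segment [K] of length [k] turns the claim
     into a pointwise inequality. *)
  have -> : y ^+ 2 / 2 + k * Ig + 16 / k * If = \int[mu]_(x in `[0, l])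
      (y ^+ 2 / (2 * k) * \1_K x + (k * g x ^+ 2 + 16 / k * f x ^+ 2)).
    rewrite !RintegralD ?RintegralZl ?IK// addrA -/Ig -/If.
    by congr (_ + _ + _); field; rewrite gt_eqF.
  apply: le_Rintegral => //.
  - apply: integrable_scale => //; apply: integrable_add => //.
    exact: integrable_scale.
  - exact: integrable_add.
  move=> x _; rewrite indicE.
  have inK : (x \in K) = (c <= x <= c + k).
    by apply/idP/idP; rewrite inE /K/= in_itv.
  have [xK|xK] := boolP (x \in K).
    have rab : `|ramp_diff a d b e x| <= 1 by exact: ramp_diff_norm.
    have db0 : 0 <= dramp b e x by exact: dramp_ge0.
    have dbk : dramp b e x * k <= 4.
      have := dramp_le b x e0; rewrite -(ler_pM2r k0) => /le_trans; apply.
      by rewrite /e le_eqVlt; apply/orP; left; apply/eqP; field; rewrite gt_eqF.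
    have rr : ramp_diff a d b e x ^+ 2 <= 1 by rewrite -real_normK ?num_real// expr_le1.
    have dd : (dramp b e x * k) ^+ 2 <= 16.
      rewrite (_ : 16 = 4 ^+ 2) ?lerXn2r ?nnegrE//; last by ring.
      by rewrite mulr_ge0// ltW.
    rewrite -(ler_pM2r k0) mulr1.
    have -> : (y ^+ 2 / (2 * k) + (k * g x ^+ 2 + 16 / k * f x ^+ 2)) * k =
      y ^+ 2 / 2 + (k * g x) ^+ 2 + 16 * f x ^+ 2 by field; rewrite gt_eqF.
    set r := ramp_diff _ _ _ _ _ in rr *; set t := dramp _ _ _ * _ in dbk dd *.
    have -> : y * (f x * dramp b e x + -1 * (g x * r)) * k =
      y * f x * t - y * r * (k * g x) by rewrite /t; ring.
    have y2 := sqr_ge0 y.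
    have h1 : y ^+ 2 * t ^+ 2 <= y ^+ 2 * 16 by rewrite ler_wpM2l.
    have h2 : y ^+ 2 * r ^+ 2 <= y ^+ 2 * 1 by rewrite ler_wpM2l.
    (* Each of the two cross terms costs [y ^+ 2 / 4], thanks to [t ^+ 2 <= 16] and [r ^+ 2 <= 1];
       together they use up the available [y ^+ 2 / 2]. *)
    have h3 := sqr_ge0 (y * t / 8 - 4 * f x).
    have h4 := sqr_ge0 (y * r / 2 + k * g x).
    nra.
  have -> : dramp b e x = 0.
    apply: dramp_out => //; apply: contra xK => /andP[bx xb].
    by rewrite inK; apply/andP; split; lra.
  (* Outside [K] the two ramps are both 0 or both 1. *)
  have -> : ramp_diff a d b e x = 0.
    have [xc|cx] := leP x c; first by rewrite /ramp_diff !ramp0 ?subrr//; lra.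
    have [xck|ckx] := leP x (c + k).
      by move: xK; rewrite inK xck ltW.
    by rewrite /ramp_diff !ramp1 ?subrr//; lra.
  rewrite !mulr0 addr0 mulr0 add0r addr_ge0// mulr_ge0 ?sqr_ge0 ?divr_ge0// ltW//.
(* With [eta / (2 * (y + 1))] in [main] the loss is at most [eta / 2]. Absorbing [y ^+ 2 / 2] on the
   left then doubles everything, which produces the constants 2 and 32. *)
apply/ler_addgt0Pr => eta eta0.
have y1 : 0 < 2 * (y + 1) by rewrite mulr_gt0// ltr_wpDl.
have := main _ (divr_gt0 eta0 y1).
have : y * (eta / (2 * (y + 1))) <= eta / 2.
  rewrite mulrA ler_pdivrMr// (_ : eta / 2 * _ = eta * y + eta); last by field.
  by rewrite mulrC; lra.
have -> : 32 / k * If = 2 * (16 / k * If) by ring.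
nra.
Qed.

(** According to the sign of [y], the one-sided version is applied to [f] or to its negative. *)
Lemma trace_two_sided l c k y f g : 0 <= c -> 0 < k -> c + k <= l ->
  sq_integrable l f -> sq_integrable l g -> real_weak_derivative l f g ->
  (forall eta : R, 0 < eta -> exists a d : R, [/\ 0 < d, c < a, a + d < c + k &
     forall x : R, a <= x <= a + d -> `|y - f x| <= eta]) ->
  y ^+ 2 <= 2 * k * \int[mu]_(x in `[0, l]) (g x ^+ 2)
           + 32 / k * \int[mu]_(x in `[0, l]) (f x ^+ 2).
Proof.
move=> c0 k0 ckl f2 g2 wfg fy; have [y0|/ltW y0] := leP 0 y.
  apply: (trace_one_sided c0 k0 ckl f2 g2 wfg y0) => eta /fy[a [d [d0 ca adk h]]].
  by exists a, d; split=> // x /h; rewrite ler_norml => /andP[? ?]; lra.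
have := @trace_one_sided l c k (- y) (fun x => -1 * f x) (fun x => -1 * g x) c0 k0 ckl.
rewrite sqrrN.
under eq_Rintegral do rewrite mulN1r sqrrN.
under [X in _ + _ / _ * X]eq_Rintegral do rewrite mulN1r sqrrN.
apply; [exact: sq_integrableZ..|exact: real_weak_derivativeZ|by rewrite oppr_ge0|].
move=> eta /fy[a [d [d0 ca adk h]]].
by exists a, d; split=> // x /h; rewrite ler_norml => /andP[? ?]; lra.
Qed.

(** The window is [[0, k]] at the left end and [[l - k, l]] at the right end. The length [k] stays
    free so that the factor of the derivative term can later be made small, at the price of a large
    [32 / k]. *)
Lemma trace_inequality l k f g : 0 < k -> k <= l ->
  {within `[0, l], continuous f} ->
  sq_integrable l g -> real_weak_derivative l f g ->
  forall x, x \in [:: 0; l] ->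
  f x ^+ 2 <= 2 * k * \int[mu]_(x in `[0, l]) (g x ^+ 2)
           + 32 / k * \int[mu]_(x in `[0, l]) (f x ^+ 2).
Proof.
move=> k0 kl cf g2 wfg x; have f2 := sq_integrable_continuous cf.
have l0 : 0 < l by lra.
have [_ f0 fl] := (continuous_within_itvP _ l0).1 cf.
rewrite !inE => /orP[]/eqP->.
  apply: (@trace_two_sided l 0 k _ f g) => // [|eta eta0]; first by rewrite add0r.
  have /cvgrPdist_le/(_ _ eta0)[r /= r0 hr] := f0.
  (* The segment [[d, 2 * d]] lies strictly inside the window and within the distance [r] of the
     endpoint given by continuity. *)
  pose d := Num.min r k / 4.
  have d0 : 0 < d by rewrite divr_gt0// lt_min r0.
  have dr : 4 * d <= r by rewrite /d mulrC divfK// ge_min lexx.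
  have dk : 4 * d <= k by rewrite /d mulrC divfK// ge_min lexx orbT.
  exists d, d; split=> //; [lra|move=> z /andP[z1 z2]].
  by apply: hr; [rewrite /= ler0_norm; lra|lra].
apply: (@trace_two_sided l (l - k) k _ f g) => // [| |eta eta0]; [by rewrite subr_ge0|by rewrite subrK|].
have /cvgrPdist_le/(_ _ eta0)[r /= r0 hr] := fl.
pose d := Num.min r k / 4.
have d0 : 0 < d by rewrite divr_gt0// lt_min r0.
have dr : 4 * d <= r by rewrite /d mulrC divfK// ge_min lexx.
have dk : 4 * d <= k by rewrite /d mulrC divfK// ge_min lexx orbT.
exists (l - 2 * d), d; split=> //; [lra|lra|move=> z /andP[z1 z2]].
by apply: hr; [rewrite /= ger0_norm; lra|lra].
Qed.

End Calculus.

(** * Complex-valued functions on an interval *)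

Section ComplexInterval.
Context {R : realType}.
Local Notation mu := (@lebesgue_measure R).
Local Notation Re := (@complex.Re R).
Local Notation Im := (@complex.Im R).
Implicit Types (l t : R) (h k g : R -> R[i]).

Lemma ReD (a b : R[i]) : Re (a + b) = Re a + Re b.
Proof. by case: a b => [? ?] [? ?]. Qed.

Lemma ImD (a b : R[i]) : Im (a + b) = Im a + Im b.
Proof. by case: a b => [? ?] [? ?]. Qed.

Lemma ReZ t (a : R[i]) : Re (t%:C%C * a) = t * Re a.
Proof. by case: a => [? ?] /=; rewrite mul0r subr0. Qed.

Lemma ImZ t (a : R[i]) : Im (t%:C%C * a) = t * Im a.
Proof. by case: a => [? ?] /=; rewrite mul0r addr0. Qed.

Lemma Re_mul_conj (a b : R[i]) : Re (a * conjc b) = Re a * Re b + Im a * Im b.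
Proof. by case: a b => [? ?] [? ?] /=; rewrite mulrN opprK. Qed.

Lemma Re_sum (I : Type) (r : seq I) (P : pred I) (F : I -> R[i]) :
  Re (\sum_(i <- r | P i) F i) = \sum_(i <- r | P i) Re (F i).
Proof. exact: (big_morph Re ReD). Qed.

Lemma L2_intervalP l h :
  L2_interval l h <-> sq_integrable l (Re \o h) /\ sq_integrable l (Im \o h).
Proof.
split=> [[mR mI int]|[[mR iR] [mI iI]]].
  split; split => //; apply: (@le_integrable _ _ _ mu _ (measurable_itv _) _ _ _ _ int).
  - by apply/measurable_EFinP; exact: measurable_funX.
  - by move=> x _; rewrite /= lee_fin !ger0_norm ?addr_ge0 ?sqr_ge0// lerDl sqr_ge0.
  - by apply/measurable_EFinP; exact: measurable_funX.
  - by move=> x _; rewrite /= lee_fin !ger0_norm ?addr_ge0 ?sqr_ge0// lerDr sqr_ge0.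
split => //; exact: (integrable_add (measurable_itv _) iR iI).
Qed.

Lemma weak_derivativeP l h g : weak_derivative l h g <->
  real_weak_derivative l (Re \o h) (Re \o g) /\
  real_weak_derivative l (Im \o h) (Im \o g).
Proof.
have rw (u : R -> R[i]) (p : R -> R) : cintegral l (fun x => u x * (p x)%:C%C) =
    Complex (\int[mu]_(x in `[0, l]) (Re (u x) * p x))
            (\int[mu]_(x in `[0, l]) (Im (u x) * p x)).
  rewrite /cintegral; congr Complex; apply: eq_Rintegral => x _.
    by rewrite mulrC ReZ mulrC.
  by rewrite mulrC ImZ mulrC.
split=> [w|[w1 w2] phi tphi]; last by rewrite !rw w1// w2.
by split=> phi tphi; have := w _ tphi; rewrite !rw => -[].
Qed.

(** The real part of the [L2] inner product. The variational argument only forms combinations with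
    real coefficients, so this real bilinear form is enough. *)
Definition dot l h k : R :=
  \int[mu]_(x in `[0, l]) (Re (h x) * Re (k x)) +
  \int[mu]_(x in `[0, l]) (Im (h x) * Im (k x)).

Lemma Re_cintegral_conj l h k : L2_interval l h -> L2_interval l k ->
  Re (cintegral l (fun x => h x * conjc (k x))) = dot l h k.
Proof.
move=> /L2_intervalP[hR hI] /L2_intervalP[kR kI] /=.
under eq_Rintegral do rewrite Re_mul_conj.
by rewrite RintegralD//; [exact: sq_integrableM hR kR|exact: sq_integrableM hI kI].
Qed.

Lemma dot_ge0 l h : 0 <= dot l h h.
Proof. by apply: addr_ge0; apply: Rintegral_ge0 => x _; rewrite -expr2 sqr_ge0. Qed.

Lemma Rintegral_sqr_comb l t (a b : R -> R) : sq_integrable l a -> sq_integrable l b ->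
  \int[mu]_(x in `[0, l]) ((a x + t * b x) * (a x + t * b x)) =
  \int[mu]_(x in `[0, l]) (a x * a x) + 2 * t * \int[mu]_(x in `[0, l]) (b x * a x)
  + t ^+ 2 * \int[mu]_(x in `[0, l]) (b x * b x).
Proof.
move=> a2 b2; have aa := sq_integrableM a2 a2; have ba := sq_integrableM b2 a2.
have bb := sq_integrableM b2 b2.
have ba' := integrable_scale (2 * t) (measurable_itv _) ba.
have bb' := integrable_scale (t ^+ 2) (measurable_itv _) bb.
have ab := integrable_add (measurable_itv _) aa ba'.
rewrite -!RintegralZl// -!RintegralD//.
by apply: eq_Rintegral => x _; ring.
Qed.

Lemma dot_comb l t h k : L2_interval l h -> L2_interval l k ->
  dot l (fun x => h x + t%:C%C * k x) (fun x => h x + t%:C%C * k x) =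
  dot l h h + 2 * t * dot l k h + t ^+ 2 * dot l k k.
Proof.
move=> /L2_intervalP[hR hI] /L2_intervalP[kR kI]; rewrite /dot.
under eq_Rintegral do rewrite !ReD !ReZ.
under [X in _ + X = _]eq_Rintegral do rewrite !ImD !ImZ.
by rewrite (Rintegral_sqr_comb t hR kR) (Rintegral_sqr_comb t hI kI); ring.
Qed.

Lemma dot_combl l t h k g : L2_interval l h -> L2_interval l k -> L2_interval l g ->
  dot l (fun x => h x + t%:C%C * k x) g = dot l h g + t * dot l k g.
Proof.
move=> /L2_intervalP[hR hI] /L2_intervalP[kR kI] /L2_intervalP[gR gI].
have hgR := sq_integrableM hR gR; have hgI := sq_integrableM hI gI.
have kgR := sq_integrableM kR gR; have kgI := sq_integrableM kI gI.
have tR := integrable_scale t (measurable_itv _) kgR.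
have tI := integrable_scale t (measurable_itv _) kgI.
rewrite /dot mulrDr addrACA; congr (_ + _); rewrite -RintegralZl// -RintegralD//;
  by apply: eq_Rintegral => x _; rewrite ?ReD ?ImD ?ReZ ?ImZ /=; ring.
Qed.

Lemma L2_interval_comb l t h k : L2_interval l h -> L2_interval l k ->
  L2_interval l (fun x => h x + t%:C%C * k x).
Proof.
move=> /L2_intervalP[hR hI] /L2_intervalP[kR kI]; apply/L2_intervalP; split.
  rewrite (_ : _ \o _ = fun x => Re (h x) + t * Re (k x)); last first.
    by apply/funext => x /=; rewrite ReD ReZ.
  by apply: sq_integrableD => //; exact: sq_integrableZ.
rewrite (_ : _ \o _ = fun x => Im (h x) + t * Im (k x)); last first.
  by apply/funext => x /=; rewrite ImD ImZ.
by apply: sq_integrableD => //; exact: sq_integrableZ.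
Qed.

Lemma weak_derivative_comb l t h1 h2 g1 g2 :
  L2_interval l h1 -> L2_interval l g1 -> L2_interval l h2 -> L2_interval l g2 ->
  weak_derivative l h1 g1 -> weak_derivative l h2 g2 ->
  weak_derivative l (fun x => h1 x + t%:C%C * h2 x) (fun x => g1 x + t%:C%C * g2 x).
Proof.
move=> /L2_intervalP[? ?] /L2_intervalP[? ?] /L2_intervalP[? ?] /L2_intervalP[? ?].
move=> /weak_derivativeP[? ?] /weak_derivativeP[? ?]; apply/weak_derivativeP.
have re (u v : R -> R[i]) : Re \o (fun x => u x + t%:C%C * v x) =
    fun x => Re (u x) + t * Re (v x).
  by apply/funext => x /=; rewrite ReD ReZ.
have im (u v : R -> R[i]) : Im \o (fun x => u x + t%:C%C * v x) =
    fun x => Im (u x) + t * Im (v x).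
  by apply/funext => x /=; rewrite ImD ImZ.
by rewrite !re !im; split; apply: real_weak_derivativeD => //;
  do ?[exact: sq_integrableZ|exact: real_weak_derivativeZ].
Qed.

Lemma wderivP l h : H1_interval l h ->
  L2_interval l (wderiv l h) /\ weak_derivative l h (wderiv l h).
Proof.
move=> [_ [g hg]].
exact: (xgetPex (fun=> 0) (ex_intro
  (fun g => L2_interval l g /\ weak_derivative l h g) g hg)).
Qed.

Lemma Rintegral_ae_eq l (a b p : R -> R) :
  sq_integrable l a -> sq_integrable l b -> sq_integrable l p ->
  {ae mu, forall x, `[0, l]%classic x -> a x = b x} ->
  \int[mu]_(x in `[0, l]) (a x * p x) = \int[mu]_(x in `[0, l]) (b x * p x).
Proof.
move=> [ma _] [mb _] [mp _] ab; congr fine; apply: ae_eq_integral => //.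
- by apply/measurable_EFinP; exact: measurable_funM.
- by apply/measurable_EFinP; exact: measurable_funM.
- have aeF := ae_filter_ringOfSetsType mu.
  by apply: filterS ab => x /[apply] /= ->.
Qed.

Lemma dot_wderivl l h g k : L2_interval l g -> weak_derivative l h g ->
  L2_interval l h -> L2_interval l k -> dot l (wderiv l h) k = dot l g k.
Proof.
move=> g2 wg h2 k2.
have [w2 ww] : L2_interval l (wderiv l h) /\ weak_derivative l h (wderiv l h).
  by apply: wderivP; split => //; exists g.
move: g2 wg k2 w2 ww => /L2_intervalP[gR gI] /weak_derivativeP[wgR wgI].
move=> /L2_intervalP[kR kI] /L2_intervalP[wR wI] /weak_derivativeP[wwR wwI].
congr (_ + _).
  exact: (Rintegral_ae_eq wR gR kR (real_weak_derivative_unique wR gR wwR wgR)).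
exact: (Rintegral_ae_eq wI gI kI (real_weak_derivative_unique wI gI wwI wgI)).
Qed.

Lemma dotC l h k : dot l h k = dot l k h.
Proof. by congr (_ + _); apply: eq_Rintegral => x _; rewrite mulrC. Qed.

(** Since [wderiv] is an arbitrary choice among weak derivatives, it is known only up to null sets;
    uniqueness lets its norm be computed from any explicit weak derivative. *)
Lemma dot_wderiv l h g : L2_interval l g -> weak_derivative l h g ->
  L2_interval l h -> dot l (wderiv l h) (wderiv l h) = dot l g g.
Proof.
move=> g2 wg h2; have [w2 _] : L2_interval l (wderiv l h) /\
    weak_derivative l h (wderiv l h).
  by apply: wderivP; split => //; exists g.
by rewrite (dot_wderivl g2)// dotC (dot_wderivl g2).
Qed.

(** As a choice, [wderiv] need not be linear pointwise. The combination of the chosen derivatives is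
    still a weak derivative of the combination, and [dot_wderiv] allows the replacement. *)
Lemma H1_interval_comb l t h k : H1_interval l h -> H1_interval l k ->
  H1_interval l (fun x => h x + t%:C%C * k x) /\
  dot l (wderiv l (fun x => h x + t%:C%C * k x))
        (wderiv l (fun x => h x + t%:C%C * k x)) =
  dot l (wderiv l h) (wderiv l h) + 2 * t * dot l (wderiv l k) (wderiv l h)
    + t ^+ 2 * dot l (wderiv l k) (wderiv l k).
Proof.
move=> Hh Hk; have [wh2 wh] := wderivP Hh; have [wk2 wk] := wderivP Hk.
have [h2 _] := Hh; have [k2 _] := Hk.
have c2 := L2_interval_comb t h2 k2; have w2 := L2_interval_comb t wh2 wk2.
have wc := weak_derivative_comb t h2 wh2 k2 wk2 wh wk.
by split; [split => //; eexists; split; [exact: w2|exact: wc]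
          |rewrite (dot_wderiv w2 wc c2) dot_comb].
Qed.

Lemma continuous_interval_comb l t h k :
  continuous_interval l h -> continuous_interval l k ->
  continuous_interval l (fun x => h x + t%:C%C * k x).
Proof.
move=> [hR hI] [kR kI]; split.
  rewrite (_ : (fun x => _) = fun x => Re (h x) + t * Re (k x)); last first.
    by apply/funext => x /=; rewrite ReD ReZ.
  by move=> x; apply: cvgD; [exact: hR|apply: cvgM; [exact: cvg_cst|exact: kR]].
rewrite (_ : (fun x => _) = fun x => Im (h x) + t * Im (k x)); last first.
  by apply/funext => x /=; rewrite ImD ImZ.
by move=> x; apply: cvgD; [exact: hI|apply: cvgM; [exact: cvg_cst|exact: kI]].
Qed.

Lemma trace_inequality_complex l (s : R) h : 0 < s -> s <= l ->
  continuous_interval l h -> H1_interval l h ->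
  forall x, x \in [:: 0; l] ->
  Re (h x) ^+ 2 + Im (h x) ^+ 2 <=
    2 * s * dot l (wderiv l h) (wderiv l h) + 32 / s * dot l h h.
Proof.
move=> s0 sl [cR cI] Hh x x0l; have [wh2 wh] := wderivP Hh.
move: wh2 wh => /L2_intervalP[wR wI] /weak_derivativeP[wdR wdI].
have := trace_inequality s0 sl cR wR wdR x0l.
have := trace_inequality s0 sl cI wI wdI x0l.
rewrite /dot /=; set a := _ ^+ 2; set b := _ ^+ 2 => h1 h2.
rewrite !mulrDr addrACA lerD//.
Qed.

End ComplexInterval.

(** * The variational principle *)

Section GraphForm.
Context {R : realType} (G : metric_graph R) (VR : {set vertex G}) (alpha : R).
Local Notation mu := (@lebesgue_measure R).
Local Notation Re := (@complex.Re R).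
Local Notation Im := (@complex.Im R).
Implicit Types f g h u w : graph_fun G.

Definition graph_dot f g : R := \sum_(e : edge G) dot (len e) (on_edge f e) (on_edge g e).

Definition dirichlet f g : R := \sum_(e : edge G)
  dot (len e) (wderiv (len e) (on_edge f e)) (wderiv (len e) (on_edge g e)).

Definition boundary_dot f g : R :=
  \sum_(v in VR) (Re (f (inl v)) * Re (g (inl v)) + Im (f (inl v)) * Im (g (inl v))).

Definition energy f g : R := dirichlet f g + alpha * boundary_dot f g.

Lemma H1_L2 f : H1 f -> L2 f.
Proof. by move=> [_ h] e; have [] := h e. Qed.

Lemma Re_inner f g : L2 f -> L2 g -> Re (inner f g) = graph_dot f g.
Proof.
move=> f2 g2; rewrite /inner Re_sum; apply: eq_bigr => e _.
exact: Re_cintegral_conj.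
Qed.

Lemma Re_robin_form f g : H1 f -> H1 g -> Re (robin_form VR alpha f g) = energy f g.
Proof.
move=> [_ Hf] [_ Hg]; rewrite /robin_form ReD ReZ !Re_sum; congr (_ + _ * _).
  apply: eq_bigr => e _; apply: Re_cintegral_conj.
    by have [] := wderivP (Hf e).
  by have [] := wderivP (Hg e).
by apply: eq_bigr => v _; rewrite Re_mul_conj.
Qed.

Lemma graph_dot_ge0 f : 0 <= graph_dot f f.
Proof. by apply: sumr_ge0 => e _; exact: dot_ge0. Qed.

Lemma L2norm_sqr f : L2 f -> L2norm f ^+ 2 = graph_dot f f.
Proof. by move=> f2; rewrite /L2norm Re_inner// sqr_sqrtr// graph_dot_ge0. Qed.

Definition comb f (t : R) u : graph_fun G := fun p => f p + t%:C%C * u p.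

Lemma H1_comb f t u : H1 f -> H1 u -> H1 (comb f t u).
Proof.
move=> [cf Hf] [cu Hu]; split=> e; last exact: (H1_interval_comb t (Hf e) (Hu e)).1.
have [cfe f0 fl] := cf e; have [cue u0 ul] := cu e; split.
- exact: continuous_interval_comb.
- by rewrite /comb /= -f0 -u0.
- by rewrite /comb /= -fl -ul.
Qed.

Lemma graph_dot_comb f t u : L2 f -> L2 u ->
  graph_dot (comb f t u) (comb f t u) =
  graph_dot f f + 2 * t * graph_dot u f + t ^+ 2 * graph_dot u u.
Proof.
move=> f2 u2; rewrite /graph_dot !mulr_sumr -!big_split/=.
by apply: eq_bigr => e _; exact: dot_comb.
Qed.

Lemma energy_comb f t u : H1 f -> H1 u ->
  energy (comb f t u) (comb f t u) =
  energy f f + 2 * t * energy u f + t ^+ 2 * energy u u.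
Proof.
move=> [_ Hf] [_ Hu]; rewrite /energy.
have -> : dirichlet (comb f t u) (comb f t u) =
    dirichlet f f + 2 * t * dirichlet u f + t ^+ 2 * dirichlet u u.
  rewrite /dirichlet !mulr_sumr -!big_split/=.
  by apply: eq_bigr => e _; exact: (H1_interval_comb t (Hf e) (Hu e)).2.
have -> : boundary_dot (comb f t u) (comb f t u) =
    boundary_dot f f + 2 * t * boundary_dot u f + t ^+ 2 * boundary_dot u u.
  rewrite /boundary_dot !mulr_sumr -!big_split/=.
  by apply: eq_bigr => v _; rewrite /comb !ReD !ImD !ReZ !ImZ; ring.
move: (dirichlet f f) (dirichlet u f) (dirichlet u u) (boundary_dot f f)
  (boundary_dot u f) (boundary_dot u u) => *; ring.
Qed.

(** Here [N], [M], [U] stand for the products of [f] with [f], of [f] with [u] and of [u] with [u],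
    and [E] for the energy of [f]. The third hypothesis says that [u - C f] has nonnegative square
    norm and gives [M <= C * N]. In the last one the terms with [z * M] and [z * U] cancel, leaving
    [(z + 2 / C) * N - M / C ^+ 2 <= E]. *)
Lemma gap_arithmetic (C z N M U E : R) : 0 < C -> U <= C ^+ 2 * N ->
  0 <= U + 2 * - C * M + (- C) ^+ 2 * N ->
  z * (N + 2 * - C^-1 * M + (- C^-1) ^+ 2 * U) <=
    E + 2 * - C^-1 * (N + z * M) + (- C^-1) ^+ 2 * (M + z * U) ->
  (z + C^-1) * N <= E.
Proof.
move=> C0 h1 h2; have MC : M <= C * N by rewrite -(ler_pM2l C0); nra.
have cc : C^-1 * C = 1 by rewrite mulVf// gt_eqF.
have c0 : 0 < C^-1 by rewrite invr_gt0.
move: (C^-1) cc c0 => c cc c0.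
have : c ^+ 2 * M <= c * N.
  rewrite (_ : c * N = c ^+ 2 * (C * N)); first by rewrite ler_wpM2l// sqr_ge0.
  by rewrite mulrA expr2 -(mulrA c) cc mulr1.
nra.
Qed.

(* If A - z is invertible with inverse bounded by C and A >= z, then with
   (A - z) u = f the form of A - z is nonnegative at f - t u; optimizing in t
   gives the strictly better lower bound z + 1 / C. *)
Lemma resolvent_form_gap (z : R) :
  resolvent_set (robin_laplacian VR alpha) z%:C%C ->
  (forall f, H1 f -> z * graph_dot f f <= energy f f) ->
  exists2 d : R, 0 < d & forall f, H1 f -> (z + d) * graph_dot f f <= energy f f.
Proof.
(* The bound [C0] of the inverse may have any sign; it is enlarged to a positive constant. *)
move=> [_ [C0 res]] zlb; pose C := `|C0| + 1.
have C_gt0 : 0 < C by rewrite ltr_wpDl.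
exists C^-1; first by rewrite invr_gt0.
move=> f Hf; have f2 := H1_L2 Hf.
have [u [Hu w2 Au] uf] := res f f2; have u2 := H1_L2 Hu.
have wE g : H1 g -> energy u g = graph_dot f g + z * graph_dot u g.
  move=> Hg; rewrite -Re_robin_form// Au// Re_inner//; last exact: H1_L2.
  rewrite /graph_dot mulr_sumr -big_split; apply: eq_bigr => e _ /=.
  exact: (dot_combl z (f2 e) (u2 e) (H1_L2 Hg e)).
have uf2 : graph_dot u u <= C ^+ 2 * graph_dot f f.
  rewrite -!L2norm_sqr// -exprMn lerXn2r// ?nnegrE ?sqrtr_ge0//.
    by rewrite mulr_ge0 ?sqrtr_ge0// ltW.
  apply: (le_trans uf); rewrite ler_wpM2r ?sqrtr_ge0// (le_trans (ler_norm _))//.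
  by rewrite lerDl.
have cross := graph_dot_ge0 (comb u (- C) f).
have := zlb _ (H1_comb (- C^-1) Hf Hu); move: cross.
rewrite energy_comb// !graph_dot_comb// !wE//.
have -> : graph_dot u f = graph_dot f u by apply: eq_bigr => e _; exact: dotC.
exact: gap_arithmetic.
Qed.

(** The number [z0] makes the set [S] of lower bounds nonempty, and the Rayleigh quotient of [f0]
    bounds it from above. The supremum belongs to [S]; were it in the resolvent set,
    [resolvent_form_gap] would put a larger number in [S]. *)
Lemma energy_minimum_spectrum f0 (z0 lambda1 : R) : H1 f0 -> 0 < graph_dot f0 f0 ->
  (forall f, H1 f -> z0 * graph_dot f f <= energy f f) ->
  is_minimum (real_spectrum (robin_laplacian VR alpha)) lambda1 ->
  forall f, H1 f -> lambda1 * graph_dot f f <= energy f f.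
Proof.
move=> Hf0 f0_gt0 z0lb [_ lmin].
pose S := [set z : R | forall f, H1 f -> z * graph_dot f f <= energy f f].
have ubS f : H1 f -> 0 < graph_dot f f -> ubound S (energy f f / graph_dot f f).
  by move=> Hf fp z Sz; rewrite ler_pdivlMr//; exact: Sz.
have supS : has_sup S by split; [exists z0|exists (energy f0 f0 / graph_dot f0 f0); exact: ubS].
have Sm : S (sup S).
  move=> f Hf; have := graph_dot_ge0 f; rewrite le_eqVlt => /predU1P[N0|Np].
    (* For a function of norm 0 the inequality reads the same for every [z], so the bound with [z0]
       settles it. *)
    by have := z0lb f Hf; rewrite -N0 !mulr0.
  by rewrite -ler_pdivlMr//; apply: ge_sup; [exact: supS.1|exact: ubS].
have : lambda1 <= sup S.
  apply: lmin => /resolvent_form_gap/(_ Sm)[d d0 Sd].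
  have := sup_upper_bound supS; move=> /(_ (sup S + d) Sd); lra.
move=> lS f Hf; apply: le_trans (Sm f Hf).
by rewrite ler_wpM2r// graph_dot_ge0.
Qed.

(** The trace inequality is applied at each Robin vertex on an incident edge. The window [s] is so
    short that all derivative terms together are absorbed by the Dirichlet integral. *)
Lemma energy_bounded_below (l : R) : 0 < l -> (forall e : edge G, l <= len e) ->
  (forall v, v \in VR -> exists e : edge G, (src e == v) || (tgt e == v)) ->
  exists z : R, forall f, H1 f -> z * graph_dot f f <= energy f f.
Proof.
move=> l0 llen inc; pose B : R := #|VR|%:R.
(* The bound by [l] makes the window fit into every edge; the summand 1 keeps the denominator
   positive even if [alpha] or [B] is 0. *)
pose s := Num.min l (1 / (2 * `|alpha| * B + 1)).
have aB0 : 0 <= `|alpha| * B by rewrite mulr_ge0.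
have aB1 : 0 < 2 * `|alpha| * B + 1 by rewrite -mulrA; lra.
have s0 : 0 < s by rewrite lt_min l0 divr_gt0.
have sl : s <= l by rewrite ge_min lexx.
have saB : 2 * s * (`|alpha| * B) <= 1.
  have : s <= 1 / (2 * `|alpha| * B + 1) by rewrite ge_min lexx orbT.
  by rewrite ler_pdivlMr//; nra.
exists (- (`|alpha| * B * (32 / s))) => f [cf Hf].
pose D := dirichlet f f; pose N := graph_dot f f.
have D0 : 0 <= D by apply: sumr_ge0 => e _; exact: dot_ge0.
have N0 : 0 <= N by exact: graph_dot_ge0.
have s32 : 0 <= 32 / s by rewrite divr_ge0// ltW.
have trace (v : vertex G) : v \in VR ->
    Re (f (inl v)) * Re (f (inl v)) + Im (f (inl v)) * Im (f (inl v)) <=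
    2 * s * D + 32 / s * N.
  move=> /inc[e ev].
  have De : dot (len e) (wderiv (len e) (on_edge f e)) (wderiv (len e) (on_edge f e)) <= D.
    by rewrite /D /dirichlet (bigD1 e)//= lerDl sumr_ge0// => e' _; exact: dot_ge0.
  have Ne : dot (len e) (on_edge f e) (on_edge f e) <= N.
    by rewrite /N /graph_dot (bigD1 e)//= lerDl sumr_ge0// => e' _; exact: dot_ge0.
  have [cfe f0 fl] := cf e.
  have tr := trace_inequality_complex s0 (le_trans sl (llen e)) cfe (Hf e).
  rewrite -!expr2; apply: (@le_trans _ _ (2 * s *
      dot (len e) (wderiv (len e) (on_edge f e)) (wderiv (len e) (on_edge f e))
      + 32 / s * dot (len e) (on_edge f e) (on_edge f e))).
    case/orP: ev => /eqP <-.
      by rewrite -f0; apply: tr; rewrite inE eqxx.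
    by rewrite -fl; apply: tr; rewrite !inE eqxx orbT.
  by apply: lerD; rewrite ler_wpM2l// mulr_ge0// ltW.
have bD : boundary_dot f f <= B * (2 * s * D + 32 / s * N).
  apply: (le_trans (ler_sum _ trace)); rewrite sumr_const /B.
  by rewrite -[leLHS]mulr_natl.
have b0 : 0 <= boundary_dot f f.
  by apply: sumr_ge0 => v _; rewrite -!expr2 addr_ge0 ?sqr_ge0.
rewrite /energy -/D -/N; move: (boundary_dot f f) b0 bD => b b0 bD.
have h1 : - (`|alpha| * b) <= alpha * b.
  by rewrite -mulNr ler_wpM2r//; have := ler_norm (- alpha); rewrite normrN; lra.
have h2 : `|alpha| * b <= `|alpha| * (B * (2 * s * D + 32 / s * N)) by rewrite ler_wpM2l.
have h3 : 2 * s * (`|alpha| * B) * D <= 1 * D by rewrite ler_wpM2r.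
move: (32 / s) h2 => q h2; nra.
Qed.

End GraphForm.

(** * Test functions *)

Section TestFunctions.
Context {R : realType}.
Local Notation mu := (@lebesgue_measure R).
Implicit Types (F f P p : R -> R) (L w : R).

(** A pointwise majorant that is the derivative of a known function integrates to a boundary term,
    so no profile has to be integrated explicitly. *)
Lemma Rintegral_energy_le L w F f P p : 0 < L ->
  has_C1_derivative F f -> has_C1_derivative P p ->
  (forall x, 0 <= x <= L -> f x ^+ 2 + w ^+ 2 * F x ^+ 2 <= p x) ->
  \int[mu]_(x in `[0, L]) (f x ^+ 2) + w ^+ 2 * \int[mu]_(x in `[0, L]) (F x ^+ 2)
    <= P L - P 0.
Proof.
move=> L0 C1F C1P h.
have f2 := (sq_integrable_dC1 L C1F).2; have F2 := (sq_integrable_C1 L C1F).2.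
have wF2 := integrable_scale (w ^+ 2) (measurable_itv _) F2.
rewrite -RintegralZl// -RintegralD// -(Rintegral_C1 L0 C1P).
apply: le_Rintegral => //.
- exact: (integrable_add (measurable_itv _) f2 wF2).
- exact: sq_integrable_integrable (sq_integrable_dC1 L C1P).
Qed.

Lemma C1_cst (c : R) : has_C1_derivative (fun=> c) (fun=> 0).
Proof.
have := C1_affine 0 c; rewrite (_ : (fun x => 0 * x + c) = fun=> c)//.
by apply/funext => x; rewrite mul0r add0r.
Qed.

Lemma C1_expR_affine (a b : R) : has_C1_derivative (fun x => expR (a * x + b))
  (fun x => expR (a * x + b) * a).
Proof. exact: (C1_comp C1_expR (C1_affine a b)). Qed.

(* If F' + w F has square at most 1 / L ^ 2, completing the square bounds
   F' ^ 2 + w ^ 2 F ^ 2 by the derivative of x / L ^ 2 - w F ^ 2. *)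
Lemma decaying_profile L w : 0 < L -> 0 < w ->
  exists F f, [/\ has_C1_derivative F f, F 0 = 1, F L = 0 &
    \int[mu]_(x in `[0, L]) (f x ^+ 2) + w ^+ 2 * \int[mu]_(x in `[0, L]) (F x ^+ 2)
    <= w + 1 / L].
Proof.
move=> L0 w0; have Ln0 : L != 0 by rewrite gt_eqF.
have C1F := C1_mul (C1_affine (- L^-1) 1) (C1_expR_affine (- w) 0).
eexists; eexists; split; first exact: C1F.
- by cbv beta; rewrite !mulr0 !add0r expR0 mul1r.
- by cbv beta; rewrite mulNr mulVf// addNr mul0r.
have C1P := C1_add (C1_affine (L^-1 ^+ 2) 0) (C1_scale (- w) (C1_mul C1F C1F)).
apply: (le_trans (Rintegral_energy_le (w := w) L0 C1F C1P _)).
  move=> x /andP[x0 xL]; rewrite addr0.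
  set E := expR _.
  have E0 : 0 < E by exact: expR_gt0.
  have E1 : E <= 1 by rewrite /E expR_le1; nra.
  have EL : (E / L) ^+ 2 <= L^-1 ^+ 2.
    by rewrite exprMn ler_piMl ?sqr_ge0// expr_le1// ltW.
  (* As [F' + w F = - E / L], the slack of the pointwise bound is exactly
     [L^-1 ^+ 2 - (E / L) ^+ 2]. *)
  move: EL; rewrite -subr_ge0 => EL; rewrite -subr_ge0.
  by apply: le_trans EL _; rewrite le_eqVlt; apply/orP; left; apply/eqP; ring.
have hL : - L^-1 * L + 1 = 0 by rewrite mulNr mulVf// addNr.
rewrite hL (_ : expR (- w * 0 + 0) = 1); last by rewrite mulr0 addr0 expR0.
by rewrite le_eqVlt; apply/orP; left; apply/eqP; field.
Qed.

(** The mirror image of the decaying profile under [x -> L - x], namely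
    [(x / L) * expR (w * (x - L))]. Now [F' - w F = E / L], and the majorant is the derivative of
    [x / L ^+ 2 + w * F ^+ 2]. *)
Lemma growing_profile L w : 0 < L -> 0 < w ->
  exists F f, [/\ has_C1_derivative F f, F 0 = 0, F L = 1 &
    \int[mu]_(x in `[0, L]) (f x ^+ 2) + w ^+ 2 * \int[mu]_(x in `[0, L]) (F x ^+ 2)
    <= w + 1 / L].
Proof.
move=> L0 w0; have Ln0 : L != 0 by rewrite gt_eqF.
have C1F := C1_mul (C1_affine L^-1 0) (C1_expR_affine w (- (w * L))).
eexists; eexists; split; first exact: C1F.
- by cbv beta; rewrite !mulr0 !add0r mul0r.
- by cbv beta; rewrite mulVf// addr0 subrr expR0 mul1r.
have C1P := C1_add (C1_affine (L^-1 ^+ 2) 0) (C1_scale w (C1_mul C1F C1F)).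
apply: (le_trans (Rintegral_energy_le (w := w) L0 C1F C1P _)).
  move=> x /andP[x0 xL]; rewrite !addr0.
  set E := expR _.
  have E0 : 0 < E by exact: expR_gt0.
  have E1 : E <= 1 by rewrite /E expR_le1; nra.
  have EL : (E / L) ^+ 2 <= L^-1 ^+ 2.
    by rewrite exprMn ler_piMl ?sqr_ge0// expr_le1// ltW.
  move: EL; rewrite -subr_ge0 => EL; rewrite -subr_ge0.
  by apply: le_trans EL _; rewrite le_eqVlt; apply/orP; left; apply/eqP; ring.
have hL : L^-1 * L + 0 = 1 by rewrite mulVf// addr0.
rewrite hL (_ : expR (w * L + - (w * L)) = 1); last by rewrite subrr expR0.
by rewrite le_eqVlt; apply/orP; left; apply/eqP; field.
Qed.

(* Here F'' = w ^ 2 F, so F' ^ 2 + w ^ 2 F ^ 2 is the derivative of F F'. *)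
Lemma loop_profile L w : 0 < L -> 0 < w ->
  exists F f, [/\ has_C1_derivative F f, F 0 = 1, F L = 1 &
    \int[mu]_(x in `[0, L]) (f x ^+ 2) + w ^+ 2 * \int[mu]_(x in `[0, L]) (F x ^+ 2)
    <= 2 * w].
Proof.
move=> L0 w0; pose q := expR (- (w * L)).
have q0 : 0 < q by exact: expR_gt0.
have q1 : q <= 1 by rewrite expR_le1 oppr_le0 mulr_ge0// ltW.
have q1n0 : 1 + q != 0 by rewrite gt_eqF// addr_gt0.
pose A x := expR (- w * x + 0); pose B x := expR (w * x + - (w * L)).
have C1A : has_C1_derivative A (fun x => - w * A x).
  have := C1_expR_affine (- w) 0; rewrite (_ : (fun x => _ * - w) = fun x => - w * A x)//.
  by apply/funext => x; rewrite mulrC.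
have C1B : has_C1_derivative B (fun x => w * B x).
  have := C1_expR_affine w (- (w * L)); rewrite (_ : (fun x => _ * w) = fun x => w * B x)//.
  by apply/funext => x; rewrite mulrC.
have A0 : A 0 = 1 by rewrite /A mulr0 addr0 expR0.
have AL : A L = q by rewrite /A addr0 mulNr.
have B0 : B 0 = q by rewrite /B mulr0 add0r.
have BL : B L = 1 by rewrite /B subrr expR0.
(* The function [(A + B) / (1 + q)] is [cosh (w (x - L / 2)) / cosh (w L / 2)], written with
   exponentials. *)
have C1F := C1_scale (1 + q)^-1 (C1_add C1A C1B).
have C1f := C1_scale (1 + q)^-1 (C1_add (C1_scale (- w) C1A) (C1_scale w C1B)).
eexists; eexists; split; first exact: C1F.
- by cbv beta; rewrite A0 B0 mulVf.
- by cbv beta; rewrite AL BL addrC mulVf// addrC.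
apply: (le_trans (Rintegral_energy_le (w := w) L0 C1F (C1_mul C1F C1f) _)).
  by move=> x _; rewrite le_eqVlt; apply/orP; left; apply/eqP; ring.
(* The boundary term equals [2 w tanh (w L / 2)]. *)
rewrite A0 AL B0 BL (_ : _ - _ = 2 * w * ((1 - q) / (1 + q))); last by field.
apply: ler_piMr; first by rewrite mulr_ge0// ltW.
by rewrite ler_pdivrMr ?addr_gt0//; lra.
Qed.

(** The booleans tell which ends of the edge lie at the chosen vertex. In all four cases the bound
    is proportional to the number of such ends, so that summation over the edges produces the
    degree. *)
Lemma edge_profile L w (a b : bool) : 0 < L -> 0 < w ->
  exists F f, [/\ has_C1_derivative F f, F 0 = a%:R, F L = b%:R &
    \int[mu]_(x in `[0, L]) (f x ^+ 2) + w ^+ 2 * \int[mu]_(x in `[0, L]) (F x ^+ 2)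
    <= (a + b)%:R * (w + 1 / L)].
Proof.
move=> L0 w0; case: a; case: b.
- have [F [f [C1F F0 FL E]]] := loop_profile L0 w0.
  exists F, f; split => //; apply: (le_trans E).
  by rewrite natrD mulr1n -mulr2n ler_wpM2l// lerDl divr_ge0// ltW.
- have [F [f [C1F F0 FL E]]] := decaying_profile L0 w0.
  by exists F, f; split => //; rewrite ?addn0 ?add0n [_ * (w + _)]mul1r.
- have [F [f [C1F F0 FL E]]] := growing_profile L0 w0.
  by exists F, f; split => //; rewrite ?addn0 ?add0n [_ * (w + _)]mul1r.
- exists (fun=> 0), (fun=> 0); split => //; first exact: C1_cst.
  by rewrite expr0n/= !Rintegral_cst// !mul0r mulr0 addr0.
Qed.

End TestFunctions.

(** * Real test functions on the graph, C^1 on each edge *)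

Section RealTestFunctions.
Context {R : realType} (G : metric_graph R).
Local Notation mu := (@lebesgue_measure R).
Local Notation Re := (@complex.Re R).
Local Notation Im := (@complex.Im R).
Context (val : vertex G -> R) (F dF : edge G -> R -> R).

Definition real_graph_fun : graph_fun G := fun p =>
  match p with inl v => (val v)%:C%C | inr (e, x) => (F e x)%:C%C end.

Context (C1F : forall e, has_C1_derivative (F e) (dF e)).
Context (F_src : forall e, F e 0 = val (src e)).
Context (F_tgt : forall e, F e (len e) = val (tgt e)).

Let f := real_graph_fun.

Let L2_real (e : edge G) (h : R -> R) : sq_integrable (len e) h ->
  L2_interval (len e) (fun x => (h x)%:C%C).
Proof.
move=> h2; apply/L2_intervalP; split; first exact: h2.
exact: sq_integrable_C1 (C1_cst 0).
Qed.

Let weak_real (e : edge G) :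
  weak_derivative (len e) (on_edge f e) (fun x => (dF e x)%:C%C).
Proof.
apply/weak_derivativeP; split.
  exact: C1_weak_derivative (len_gt0 e) (C1F e).
exact: C1_weak_derivative (len_gt0 e) (C1_cst 0).
Qed.

Let dot_real l (h : R -> R) : dot l (fun x => (h x)%:C%C) (fun x => (h x)%:C%C) =
  \int[mu]_(x in `[0, l]) (h x ^+ 2).
Proof.
rewrite /dot /= [X in _ + X](_ : _ = 0) ?addr0.
  by apply: eq_Rintegral => x _; rewrite expr2.
by under eq_Rintegral do rewrite mulr0; rewrite Rintegral_cst// mul0r.
Qed.

Lemma H1_real_graph_fun : H1 f.
Proof.
split=> e.
  split; [split|by rewrite /on_edge /= F_src|by rewrite /on_edge /= F_tgt].
    exact: C1_within (C1F e).
  exact: C1_within (C1_cst 0).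
split; first exact: L2_real (sq_integrable_C1 _ (C1F e)).
exists (fun x => (dF e x)%:C%C); split; last exact: weak_real.
exact: L2_real (sq_integrable_dC1 _ (C1F e)).
Qed.

Lemma graph_dot_real_graph_fun :
  graph_dot f f = \sum_(e : edge G) \int[mu]_(x in `[0, len e]) (F e x ^+ 2).
Proof. by apply: eq_bigr => e _; exact: dot_real. Qed.

Lemma dirichlet_real_graph_fun :
  dirichlet f f = \sum_(e : edge G) \int[mu]_(x in `[0, len e]) (dF e x ^+ 2).
Proof.
apply: eq_bigr => e _; rewrite (dot_wderiv _ (@weak_real e)) ?dot_real//.
  exact: L2_real (sq_integrable_dC1 _ (C1F e)).
exact: L2_real (sq_integrable_C1 _ (C1F e)).
Qed.

Lemma boundary_dot_real_graph_fun (VR : {set vertex G}) :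
  boundary_dot VR f f = \sum_(v in VR) val v ^+ 2.
Proof. by apply: eq_bigr => v _; rewrite /= mulr0 addr0 expr2. Qed.

End RealTestFunctions.

(** * Degrees and incident edges *)

Section Degree.
Context {R : realType} (G : metric_graph R).

Lemma deg_sum (v : vertex G) :
  (deg v = \sum_(e : edge G) ((src e == v) + (tgt e == v)))%N.
Proof.
have cnt (p : pred (edge G)) : #|[set e | p e]%classic| = (\sum_e p e)%N.
  rewrite -sum1_card big_mkcond; apply: eq_bigr => e _.
  by have -> : (e \in [set e | p e]%classic) = p e by apply/idP/idP; rewrite inE.
by rewrite big_split /deg !cnt.
Qed.

(** A path from [v] to the source of [e0] either is empty, and then [e0] itself is incident with
    [v], or begins with an edge at [v]. The given edge rules out a single vertex without edges. *)
Lemma connected_incident_edge (e0 : edge G) : graph_connected G ->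
  forall v, exists e : edge G, (src e == v) || (tgt e == v).
Proof.
move=> conn v; have /connectP[[|w p] /= pth lst] := conn v (src e0).
  by exists e0; rewrite lst eqxx.
move: pth => /andP[/existsP[e /orP[]/andP[/eqP h1 /eqP h2]] _]; exists e.
  by rewrite h1 eqxx.
by rewrite h2 eqxx orbT.
Qed.

End Degree.

(** * The two eigenvalue bounds *)

Section RayleighBounds.
Context {R : realType} (G : metric_graph R) (VR : {set vertex G}) (alpha lambda1 : R).
Local Notation mu := (@lebesgue_measure R).
Context (conn : graph_connected G) (l : R).
Context (l_min : is_minimum (edge_lengths G) l).

Lemma shortest_edge : exists e0 : edge G, len e0 = l.
Proof. by have [[e0 _ <-] _] := l_min; exists e0. Qed.

Lemma shortest_edge_le (e : edge G) : l <= len e.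
Proof. by have [_ lb] := l_min; apply: lb; exists e. Qed.

Lemma shortest_edge_gt0 : 0 < l.
Proof. by have [e0 <-] := shortest_edge; exact: len_gt0. Qed.

Lemma incident_edge (v : vertex G) : exists e : edge G, (src e == v) || (tgt e == v).
Proof. by have [e0 _] := shortest_edge; exact: connected_incident_edge. Qed.

Lemma deg_gt0 (v : vertex G) : (0 < deg v)%N.
Proof.
have [e ev] := incident_edge v; rewrite deg_sum (bigD1 e)//= !addn_gt0.
by case/orP: ev => ->; rewrite ?orbT.
Qed.

(** It serves twice: as the function of positive norm that bounds the set of lower bounds from
    above, and as the test function for the bound by the average. *)
Let unit_fun := @real_graph_fun R G (fun=> 1) (fun _ _ => 1).

Let H1_unit : H1 unit_fun.
Proof. by apply: (@H1_real_graph_fun R G _ _ (fun _ _ => 0)) => // e; exact: C1_cst. Qed.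

Let graph_dot_unit : graph_dot unit_fun unit_fun = total_length G.
Proof.
rewrite graph_dot_real_graph_fun; apply: eq_bigr => e _.
rewrite expr1n Rintegral_cst// mul1r.
suff h : fine (mu `[0, len e]%classic) = len e by exact: h.
by rewrite lebesgue_measure_itv/= lte_fin len_gt0/= subr0.
Qed.

Lemma total_length_gt0 : 0 < total_length G.
Proof.
have [e0 _] := shortest_edge.
by rewrite /total_length (bigD1 e0)//= ltr_wpDr ?len_gt0// sumr_ge0// => e _; rewrite ltW ?len_gt0.
Qed.

Context (lambda1_min : is_minimum (real_spectrum (robin_laplacian VR alpha)) lambda1).

Lemma rayleigh_bound f : H1 f -> lambda1 * graph_dot f f <= energy VR alpha f f.
Proof.
have [z zlb] := energy_bounded_below alpha shortest_edge_gt0 shortest_edge_le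
  (fun v (_ : v \in VR) => incident_edge v).
apply: (energy_minimum_spectrum H1_unit _ zlb lambda1_min).
by rewrite graph_dot_unit total_length_gt0.
Qed.

Lemma lambda1_le_average : lambda1 <= #|VR|%:R * alpha / total_length G.
Proof.
rewrite ler_pdivlMr ?total_length_gt0// -graph_dot_unit.
apply: (le_trans (rayleigh_bound H1_unit)).
rewrite /energy (@dirichlet_real_graph_fun R G _ _ (fun _ _ => 0)); last first.
  by move=> e; exact: C1_cst.
rewrite boundary_dot_real_graph_fun expr1n sumr_const.
rewrite big1 ?add0r; first by rewrite mulrC.
by move=> e _; rewrite expr0n/= Rintegral_cst// mul0r.
Qed.

(** The test function is 1 at [v] and 0 at every other vertex, so its boundary term is exactly 1,
    however many Robin vertices there are. *)
Lemma lambda1_le_local (v : vertex G) : v \in VR -> alpha < - ((deg v)%:R / l) ->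
  lambda1 <= - (alpha / (deg v)%:R + 1 / l) ^+ 2.
Proof.
move=> vVR al; have l0 := shortest_edge_gt0.
have D0 : 0 < (deg v)%:R :> R by rewrite ltr0n deg_gt0.
(* The rate [w] solves [deg v * (w + 1 / l) = - alpha], and the hypothesis on [alpha] is precisely
   its positivity. *)
pose w := - (alpha / (deg v)%:R + 1 / l).
have w0 : 0 < w.
  rewrite /w oppr_gt0 -(ltr_pM2r D0) mul0r mulrDl divfK ?gt_eqF// mul1r mulrC.
  lra.
have /choice[P hP] : forall e : edge G, exists P : (R -> R) * (R -> R),
    [/\ has_C1_derivative P.1 P.2, P.1 0 = (src e == v)%:R, P.1 (len e) = (tgt e == v)%:R &
    \int[mu]_(x in `[0, len e]) (P.2 x ^+ 2)
      + w ^+ 2 * \int[mu]_(x in `[0, len e]) (P.1 x ^+ 2)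
    <= ((src e == v) + (tgt e == v))%:R * (w + 1 / len e)].
  move=> e; have [F [f h]] := edge_profile (src e == v) (tgt e == v) (len_gt0 e) w0.
  by exists (F, f).
pose val (u : vertex G) : R := (u == v)%:R.
pose f := real_graph_fun val (fun e => (P e).1).
have C1P e : has_C1_derivative (P e).1 (P e).2 by have [] := hP e.
have Hf : H1 f.
  apply: (@H1_real_graph_fun R G _ _ (fun e => (P e).2)) => //.
    by move=> e; have [] := hP e.
  by move=> e; have [] := hP e.
have bE : boundary_dot VR f f = 1.
  rewrite boundary_dot_real_graph_fun (bigD1 v)//= /val eqxx expr1n big1 ?addr0//.
  by move=> u /andP[_ /negbTE ->]; rewrite expr0n.
have N0 : 0 < graph_dot f f.
  rewrite lt_def graph_dot_ge0 andbT; apply/negP => /eqP N0.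
  (* a function of norm 0 would violate the lower bound of the form for
     a sufficiently negative Robin parameter *)
  have [z /(_ f Hf)] := energy_bounded_below (- dirichlet f f - 1) l0
    shortest_edge_le (fun u (_ : u \in VR) => incident_edge u).
  by rewrite N0 mulr0 /energy bE mulr1; lra.
have sumE : dirichlet f f + w ^+ 2 * graph_dot f f <= (deg v)%:R * (w + 1 / l).
  rewrite (dirichlet_real_graph_fun _ C1P) graph_dot_real_graph_fun.
  rewrite mulr_sumr -big_split deg_sum natr_sum mulr_suml/=.
  apply: ler_sum => e _; have [_ _ _ h] := hP e; apply: (le_trans h).
  (* Edges longer than [l] only improve the bound, since [1 / len e <= 1 / l]. *)
  rewrite ler_wpM2l// lerD2l ler_pM2l// lef_pV2 ?posrE ?len_gt0//.
  exact: shortest_edge_le.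
have := rayleigh_bound Hf; rewrite /energy bE mulr1 => h.
rewrite -(ler_pM2r N0) -[_ + 1 / l]opprK -/w sqrrN.
have wE : (deg v)%:R * (w + 1 / l) = - alpha.
  by rewrite /w; field; rewrite !gt_eqF.
by rewrite mulNr; lra.
Qed.

End RayleighBounds.

Theorem mainTheorem6 (R : realType) (G : metric_graph R)
  (hconn : graph_connected G)
  (VR : {set vertex G}) (k : nat) (hk : #|VR| = k) (hk1 : (1 <= k)%N)
  (D : nat) (hD : is_minimum [set n : nat | exists2 v, v \in VR & deg v = n] D)
  (l : R) (hl : is_minimum (edge_lengths G) l)
  (alpha : R) (halpha : alpha < 0)
  (lambda1 : R)
  (hlambda1 : is_minimum (real_spectrum (robin_laplacian VR alpha)) lambda1) :
  - (D%:R / l) < 0 /\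
  (alpha < - (D%:R / l) ->
    lambda1 <= - (alpha ^+ 2 / D%:R ^+ 2) - 2 * alpha / (D%:R * l) - 1 / l ^+ 2
    /\ - (alpha ^+ 2 / D%:R ^+ 2) - 2 * alpha / (D%:R * l) - 1 / l ^+ 2
       = - (alpha / D%:R + 1 / l) ^+ 2) /\
  lambda1 <= k%:R * alpha / total_length G.
Proof.
have [[v vVR <-] _] := hD.
have l0 := shortest_edge_gt0 hl.
have D0 : 0 < (deg v)%:R :> R by rewrite ltr0n (deg_gt0 hconn hl).
have square : - (alpha ^+ 2 / (deg v)%:R ^+ 2) - 2 * alpha / ((deg v)%:R * l) - 1 / l ^+ 2
    = - (alpha / (deg v)%:R + 1 / l) ^+ 2.
  by field; rewrite !gt_eqF.
split; first by rewrite oppr_lt0 divr_gt0.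
split; last by rewrite -hk; exact: (lambda1_le_average hconn hl hlambda1).
by move=> al; split=> //; rewrite square; exact: (lambda1_le_local hconn hl hlambda1 vVR al).
Qed.
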